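(* Algebraic functions are integral: if $U\subset\mathbb C$ is a connected open set and $y:U\to\mathbb C$ is a holomorphic function for which there is a nonzero polynomial $P\in\mathbb C[z,y]$ with $P(z,y(z))=0$, then $y$ is an integral function.
   Context: For a holomorphic function $f:U\to\mathbb C$ of the variable $z$ and $n\in\mathbb N_0$ put $f^{[n]}:=\frac{1}{n!}\frac{d^nf}{dz^n}$. A finitely generated $\mathbb Z$-algebra $\mathbb Z[x]=\mathbb Z[x_1,\dots,x_N]$ generated by holomorphic functions $x_i:U\to\mathbb C$ is called integral if it is closed under $f\mapsto f^{[n]}$ for all $n\in\mathbb N_0$. A holomorphic function $y:U\to\mathbb C$ is called integral if it belongs to some integral $\mathbb Z$-algebra $\mathbb Z[x]$. *)

(* Defs.v *)
From mathcomp Require Import all_boot all_order all_algebra.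
From mathcomp Require Import complex.
From mathcomp Require Import all_classical all_reals all_analysis.
(* mpoly's notations clash with those of mathcomp-analysis *)
From mathcomp Require Import -(notations) mpoly.

Set Implicit Arguments.
Unset Strict Implicit.
Unset Printing Implicit Defensive.

Import Order.TTheory GRing.Theory Num.Theory.
Import numFieldNormedType.Exports.

Local Open Scope classical_set_scope.
Local Open Scope ring_scope.

(* R[i] seen through its numFieldType structure, from which the library derives
   its norm topology and its structure of normed module over itself. *)
Notation Cplx R :=
  (Num.NumField.sort (complex_complex__canonical__Num_NumField R)).

(* A function U -> C is encoded by a total function on C, of which only
   the values on U matter; U is always an open set. *)

Section IntegralFunctions.
Variable R : realType.
Implicit Types (U : set (Cplx R)) (f : Cplx R -> Cplx R).

Definition holomorphic U f : Prop := forall z, U z -> derivable f z 1.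

Definition divided_derivative (n : nat) f : Cplx R -> Cplx R :=
  fun z => (n`!%:R)^-1 * derive1n n f z.

(* The ring Z[x_1, ..., x_N] of functions on U. *)
Definition generated_algebra U (N : nat) (x : 'I_N -> Cplx R -> Cplx R) :
    set (Cplx R -> Cplx R) :=
  [set f | exists p : mpoly N int,
     forall z, U z -> f z = mmap (intmul 1) (fun i => x i z) p].

Definition integral_algebra U (N : nat) (x : 'I_N -> Cplx R -> Cplx R) : Prop :=
  (forall i, holomorphic U (x i)) /\
  forall f n, generated_algebra U x f ->
    generated_algebra U x (divided_derivative n f).

Definition integral_function U f : Prop :=
  exists (N : nat) (x : 'I_N -> Cplx R -> Cplx R),
    integral_algebra U x /\ generated_algebra U x f.

End IntegralFunctions.

(* Main.v *)
Require Import Defs.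
From mathcomp Require Import all_boot all_order all_algebra.
From mathcomp Require Import complex cyclic separable cyclotomic.
From mathcomp Require Import all_classical all_reals all_analysis.
From mathcomp Require Import -(notations) mpoly.
From mathcomp Require Import ring.

Set Implicit Arguments.
Unset Strict Implicit.
Unset Printing Implicit Defensive.

Import Order.TTheory GRing.Theory Num.Theory.
Import numFieldNormedType.Exports.

Local Open Scope classical_set_scope.
Local Open Scope ring_scope.

(** Let y be holomorphic on U with P(z,y) = 0. Suppose first that Q(z,w) = 0
    for a holomorphic w such that Q_w(z,w) has no zero on U. Applying the n-th
    divided derivative to this relation, and the Leibniz rule without binomial
    coefficients that divided derivatives obey, gives Q_w(z,w) w^[n] as a
    polynomial with integer coefficients in z, w, w^[1], ..., w^[n-1] and the
    coefficients of Q. By induction every w^[n] lies in the ring generated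
    over Z by z, w, 1/Q_w(z,w) and these coefficients, and so do the divided
    derivatives of 1/Q_w(z,w). So this ring is integral, and it remains so
    when the coefficients of a polynomial S are adjoined; then it contains
    S(z,w) ([etale_integral_function]).

    It remains to write y as such an S(z,w) ([etale_model]). An annihilator P
    of y of least degree is coprime to P_y, so some nonzero r(z) is a
    combination u P + v P_y ([separable_annihilator]). If P_y(z,y) vanishes at
    a point a of U, the function y is replaced by w = (y - y(a)) / (z - a),
    that is, the curve is blown up. Because y is differentiable at a, the
    polynomial P(z, y(a) + (z - a) w) is divisible by (z - a)^2, and its
    quotient Q satisfies a relation of the same kind with r replaced by r / (z
    - a) ([blowup]). The degree of r bounds the number of steps.

    The function w must be differentiable at a. For general holomorphic
    functions this is a consequence of Cauchy's formula; for algebraic ones it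
    has an elementary proof ([algebraic_derivable]). A bounded continuous
    algebraic function on a punctured disc has a limit at the puncture,
    because its values accumulate only at the finitely many roots of a
    polynomial and the punctured disc is connected ([algebraic_limit]). If
    this limit is 0 the function is O(z): single-valuedness excludes
    fractional exponents ([algebraic_vanishing]). Together these give the
    derivative of any continuous algebraic function. *)

(** * Bivariate polynomials *)

Section Bivariate.
Variable K : numFieldType.
Implicit Types (P Q : {poly {poly K}}) (p q : {poly K}) (z y : K).

Definition eval2 P z y : K := P.[y%:P].[z].

Definition specialize z P : {poly K} := map_poly (horner_eval z) P.

Lemma eval2E P z y : eval2 P z y = (specialize z P).[y].
Proof.
rewrite /eval2 /specialize -{2}[y](hornerC y z).
by rewrite -[(y%:P).[z]]/(horner_eval z y%:P) horner_map.
Qed.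

Lemma eval20 z y : eval2 0 z y = 0.
Proof. by rewrite /eval2 !horner0. Qed.

Lemma eval2D P Q z y : eval2 (P + Q) z y = eval2 P z y + eval2 Q z y.
Proof. by rewrite /eval2 !hornerD. Qed.

Lemma eval2M P Q z y : eval2 (P * Q) z y = eval2 P z y * eval2 Q z y.
Proof. by rewrite /eval2 !hornerM. Qed.

Lemma eval2C p z y : eval2 p%:P z y = p.[z].
Proof. by rewrite /eval2 hornerC. Qed.

Lemma eval2X z y : eval2 'X z y = y.
Proof. by rewrite /eval2 hornerX hornerC. Qed.

Definition substitute q Q P : {poly {poly K}} := map_poly (comp_poly q) P \Po Q.

Lemma eval2_substitute q Q P z y :
  eval2 (substitute q Q P) z y = eval2 P q.[z] (eval2 Q z y).
Proof.
rewrite /substitute; elim/poly_ind: P => [|P p IH].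
  by rewrite map_poly0 comp_poly0 /eval2 !horner0.
rewrite rmorphD rmorphM /= map_polyX map_polyC /= comp_polyD comp_polyM.
rewrite comp_polyX comp_polyC !eval2D !eval2M IH !eval2C eval2X.
by rewrite horner_comp.
Qed.

Lemma substitute_neq0 q Q P : (1 < size q)%N -> (1 < size Q)%N ->
  P != 0 -> substitute q Q P != 0.
Proof.
move=> q1 Q1; rewrite /substitute comp_poly_eq0 //.
apply: contra_neq => /polyP P0; apply/polyP => i; apply/eqP.
by move/eqP: (P0 i); rewrite coef_map !coef0 /= comp_poly_eq0.
Qed.

Lemma deriv_substitute q Q P :
  (substitute q Q P)^`() = substitute q Q P^`() * Q^`().
Proof. by rewrite /substitute deriv_comp -deriv_map. Qed.

Lemma substituteD q Q P1 P2 :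
  substitute q Q (P1 + P2) = substitute q Q P1 + substitute q Q P2.
Proof. by rewrite /substitute rmorphD /= comp_polyD. Qed.

Lemma substituteM q Q P1 P2 :
  substitute q Q (P1 * P2) = substitute q Q P1 * substitute q Q P2.
Proof. by rewrite /substitute rmorphM /= comp_polyM. Qed.

Lemma substituteC q Q p : substitute q Q p%:P = (p \Po q)%:P.
Proof. by rewrite /substitute map_polyC comp_polyC. Qed.

Lemma specialize_eq0 z P :
  specialize z P = 0 -> exists Q, P = ('X - z%:P)%:P * Q.
Proof.
move=> P0; exists (map_poly (fun p => p %/ ('X - z%:P)) P).
apply/polyP => i; rewrite coefCM coef_map_id0 ?div0p //.
move/polyP/(_ i): P0; rewrite coef_map coef0 => /eqP.
by rewrite -[_ == 0]/(root P`_i z) -dvdp_XsubCl => /divpK; rewrite mulrC.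
Qed.

Lemma specialize_factor z P : P != 0 ->
  exists n Q, P = (('X - z%:P) ^+ n)%:P * Q /\ specialize z Q != 0.
Proof.
move=> P0.
have [i Pi0] : exists i, P`_i != 0.
  by exists (size P).-1; rewrite -lead_coefE lead_coef_eq0.
have [m] := ubnP (size P`_i); elim: m P P0 Pi0 => // m IH P P0 Pi0 sP.
have [/specialize_eq0[Q PQ]|Pz] := eqVneq (specialize z P) 0; last first.
  by exists 0%N, P; rewrite expr0 mul1r.
have Qi0 : Q`_i != 0 by apply: contraNneq Pi0 => Qi; rewrite PQ coefCM Qi mulr0.
have Q0 : Q != 0 by apply: contraNneq Qi0 => ->; rewrite coef0.
have [|n [Q' [QQ' Q'z]]] := IH Q Q0 Qi0.
  rewrite -ltnS (leq_trans _ sP)// ltnS PQ coefCM.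
  by rewrite size_mul ?polyXsubC_eq0// size_XsubC.
exists n.+1, Q'; split=> //.
by rewrite PQ QQ' mulrA -polyCM exprS.
Qed.

(** The multiplicity of y as a root of p' is strictly less than its
    multiplicity as a root of p, so a common divisor of p and p' cannot absorb
    all the factors X - y of p. *)
Lemma root_cofactor p g h k c d y : p != 0 -> c != 0 -> d != 0 ->
  c *: p = h * g -> d *: p^`() = k * g -> root p y -> root h y.
Proof.
move=> p0 c0 d0 ph pk py; apply: contraT => hy.
have [m [s [sy ps]]] := multiplicity_XsubC p y.
rewrite p0 /= in sy.
have m0 : (0 < m)%N.
  by case: m ps => // ps; move: py; rewrite ps expr0 mulr1 (negPf sy).
have mg : ('X - y%:P) ^+ m %| g.
  rewrite -(@Gauss_dvdpr _ _ h).
    by rewrite -ph dvdpZr// ps dvdp_mulIr.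
  by rewrite coprimep_expl // coprimep_sym coprimep_XsubC.
have : ('X - y%:P) ^+ m %| p^`().
  by rewrite -(dvdpZr _ _ d0) pk dvdp_mull.
case: m m0 {mg} ps => // m _ ->.
rewrite derivM deriv_exp derivXsubC mul1r /= exprS -mulr_natr.
have -> : s^`() * (('X - y%:P) * ('X - y%:P) ^+ m) +
    s * (('X - y%:P) ^+ m * m.+1%:R) =
    (s^`() * ('X - y%:P) + s * m.+1%:R) * ('X - y%:P) ^+ m by ring.
rewrite dvdp_mul2r; last by rewrite expf_neq0 // polyXsubC_eq0.
rewrite dvdp_XsubCl rootE !hornerE subrr mulr0 add0r.
rewrite -polyC_natr hornerC mulf_eq0 pnatr_eq0 /=.
by move/negPf: sy; rewrite rootE => ->.
Qed.

(** An annihilator of least degree in y is coprime to its derivative: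
    otherwise the cofactor of their gcd, which by [root_cofactor] still
    vanishes along the curve for almost all z, would give, after multiplication
    by a polynomial in z, an annihilator of smaller degree. The resultant then
    provides the Bezout relation. *)
Lemma separable_annihilator (A : set K) (y : K -> K) P :
  (forall p, (forall z, A z -> p.[z] = 0) -> p = 0) ->
  P != 0 -> (forall z, A z -> eval2 P z (y z) = 0) ->
  exists Q u v r, [/\ r != 0, r%:P = u * Q + v * Q^`() &
    forall z, A z -> eval2 Q z (y z) = 0].
Proof.
move=> Adense.
have [m] := ubnP (size P); elim: m P => // m IH P sP P0 Py.
have sP1 : (1 < size P)%N.
  rewrite ltnNge; apply: contra_neqN P0 => /size1_polyC PE.
  rewrite PE (Adense P`_0) ?polyC0 // => z Az.
  by rewrite -(eval2C P`_0 z (y z)) -PE Py.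
have P'0 : P^`() != 0.
  apply: contra_neq P0 => /polyP/(_ (size P).-2); rewrite coef_deriv coef0.
  rewrite prednK -?subn1 ?subn_gt0 // subn1 -lead_coefE => /eqP.
  rewrite -mulr_natr mulf_eq0 -polyC_natr polyC_eq0 pnatr_eq0 lead_coef_eq0.
  by case/predU1P=> //; rewrite -subn1 subn_eq0 leqNgt sP1.
have [sP'1|sP'1] := leqP (size P^`()) 1.
  exists P, 0, 1, P^`()`_0; split=> //; last first.
    by rewrite mul0r add0r mul1r -size1_polyC.
  by apply: contraNneq P'0 => r0; rewrite (size1_polyC sP'1) r0.
have [R0|R0] := eqVneq (resultant P P^`()) 0; last first.
  by have [[u v] /= _ uvE] := resultant_in_ideal sP1 sP'1;
     exists P, u, v, (resultant P P^`()).
have sG : (1 < size (gcdp P P^`()))%N by rewrite -resultant_eq0 R0.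
set G := gcdp P P^`() in sG.
have /Pdiv.Idomain.dvdpP[[c H] /= c0 PH] : G %| P by exact: dvdp_gcdl.
have /Pdiv.Idomain.dvdpP[[d k] /= d0 P'k] : G %| P^`() by exact: dvdp_gcdr.
have H0 : H != 0.
  by apply: contra_neq P0 => H0; apply/eqP; move/eqP: PH;
     rewrite H0 mul0r scale_poly_eq0 (negPf c0).
have G0 : G != 0 by rewrite -size_poly_gt0 (leq_trans _ sG).
(* Outside the zeros of e, specialization at z keeps P nonzero and both
   divisibilities nontrivial; at its zeros e *: H vanishes for free. *)
pose e := c * d * lead_coef P.
have e0 : e != 0 by rewrite !mulf_neq0 // lead_coef_eq0.
apply: (IH (e *: H)) => [||z Az].
- rewrite size_scale // -ltnS (leq_trans _ sP) // ltnS.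
  have := size_mul H0 G0; rewrite -PH size_scale // => ->.
  by rewrite -subn1 ltn_subRL addnC ltn_add2l.
- by rewrite scale_poly_eq0 negb_or e0.
rewrite -mul_polyC eval2M eval2C; apply/eqP; rewrite mulf_eq0.
have [//|ez /=] := eqVneq e.[z] 0.
move: ez; rewrite !hornerM !mulf_eq0 !negb_or -andbA => /and3P[cz dz lz].
rewrite eval2E -rootE.
apply: (@root_cofactor (specialize z P) (specialize z G) _ (specialize z k)
  c.[z] d.[z]) => //.
- apply: contraNneq lz => /polyP/(_ (size P).-1).
  by rewrite coef_map coef0 lead_coefE => /eqP.
- by rewrite /specialize -rmorphM -PH /= map_polyZ.
- by rewrite /specialize -rmorphM -P'k deriv_map /= map_polyZ.
by rewrite rootE -eval2E Py.
Qed.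

End Bivariate.

(** * Function rings closed under divided derivatives *)

Section FunctionRings.
Variables (K : numFieldType) (U : set K).
Implicit Types (B : set (K -> K)) (f g w : K -> K) (P : {poly {poly K}}).

(** Functions matter only through their values on U, so a ring of functions is
    required to be stable under equality on U. *)
Definition function_ring B : Prop :=
  [/\ forall f g, B f -> (forall z, U z -> f z = g z) -> B g,
      B (fun=> 1),
      forall f g, B f -> B g -> B (fun z => f z - g z) &
      forall f g, B f -> B g -> B (fun z => f z * g z)].

Lemma function_ring0 B : function_ring B -> B (fun=> 0).
Proof.
by case=> Bext B1 Bsub _; apply: Bext (Bsub _ _ B1 B1) _ => z _; rewrite subrr.
Qed.

Lemma function_ringD B f g :
  function_ring B -> B f -> B g -> B (fun z => f z + g z).
Proof.
move=> rB Bf Bg; have B0 := function_ring0 rB; case: rB => Bext _ Bsub _.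
apply: Bext (Bsub _ _ Bf (Bsub _ _ B0 Bg)) _ => z _.
by rewrite sub0r opprK.
Qed.

Lemma function_ring_sum B (I : Type) (r : seq I) (S : pred I)
    (F : I -> K -> K) :
  function_ring B -> (forall i, S i -> B (F i)) ->
  B (fun z => \sum_(i <- r | S i) F i z).
Proof.
move=> rB BF; elim: r => [|i r IH].
  by case: (rB) => Bext _ _ _; apply: Bext (function_ring0 rB) _ => z _;
    rewrite big_nil.
case: (rB) => Bext _ _ _; have [Si|Si] := boolP (S i); last first.
  by apply: Bext IH _ => z _; rewrite big_cons (negPf Si).
apply: Bext (function_ringD rB (BF i Si) IH) _ => z _.
by rewrite big_cons Si.
Qed.

Lemma poly2_ind_over (C : K -> Prop) (H : {poly {poly K}} -> Prop) :
  H 0 ->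
  (forall c, C c -> H c%:P%:P) ->
  (forall p, H p%:P -> H (p * 'X)%:P) ->
  (forall P, H P -> H (P * 'X)) ->
  (forall P Q, H P -> H Q -> H (P + Q)) ->
  forall P, (forall i j, C P`_i`_j) -> H P.
Proof.
move=> H0 HC HX HY HD; elim/poly_ind => [//|P p IH] CP.
have Cp i : C p`_i by have := CP 0 i; rewrite coefD coefMX coefC add0r.
apply: (HD); first by apply/HY/IH => i j; have := CP i.+1 j;
  rewrite coefD coefMX coefC addr0.
clear P IH CP; elim/poly_ind: p Cp => [//|p c IH Cp].
rewrite polyCD; apply: HD; last by apply: HC; have := Cp 0;
  rewrite coefD coefMX coefC add0r.
by apply/HX/IH => i; have := Cp i.+1; rewrite coefD coefMX coefC addr0.
Qed.

Definition has_constants B P : Prop := forall i j, B (fun=> P`_i`_j).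

Lemma function_ring_eval2 B w P : function_ring B -> has_constants B P ->
  B id -> B w -> B (fun z => eval2 P z (w z)).
Proof.
move=> rB + BX Bw; have := rB; case=> Bext _ _ Bmul.
apply: (@poly2_ind_over (fun c => B (fun=> c))
  (fun P => B (fun z => eval2 P z (w z)))) => {P}.
- by apply: Bext (function_ring0 rB) _ => z _; rewrite /eval2 !horner0.
- by move=> c Bc; apply: Bext Bc _ => z _; rewrite eval2C hornerC.
- move=> p Bp; apply: Bext (Bmul _ _ Bp BX) _ => z _.
  by rewrite !eval2C hornerMX.
- move=> P BP; apply: Bext (Bmul _ _ BP Bw) _ => z _.
  by rewrite eval2M eval2X.
move=> P Q BP BQ; apply: Bext (function_ringD rB BP BQ) _ => z _.
by rewrite eval2D.
Qed.

Lemma has_constants_deriv B P :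
  function_ring B -> has_constants B P -> has_constants B P^`().
Proof.
move=> rB BP i j; case: (rB) => Bext _ _ _.
apply: Bext (function_ring_sum (index_enum 'I_i.+1) (S := xpredT) rB
  (fun _ _ => BP i.+1 j)) _ => z _ /=.
by rewrite sumr_const card_ord coef_deriv coefMn.
Qed.

Lemma has_constants_map_deriv B P : function_ring B ->
  has_constants B P -> has_constants B (map_poly deriv P).
Proof.
move=> rB BP i j; case: (rB) => Bext _ _ _.
apply: Bext (function_ring_sum (index_enum 'I_j.+1) (S := xpredT) rB
  (fun _ _ => BP i j.+1)) _ => z _ /=.
by rewrite sumr_const card_ord coef_map coef_deriv.
Qed.

Lemma is_derive_eval2 P w (z dw : K) : is_derive z 1 w dw ->
  is_derive z 1 (fun t => eval2 P t (w t))
    (eval2 (map_poly deriv P) z (w z) + eval2 P^`() z (w z) * dw).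
Proof.
move=> dwz.
apply: (@poly2_ind_over (fun=> True) (fun P =>
  is_derive z 1 (fun t => eval2 P t (w t))
    (eval2 (map_poly deriv P) z (w z) + eval2 P^`() z (w z) * dw))) => // {P}.
- rewrite map_poly0 deriv0 !eval20 mul0r add0r (_ : (fun _ => _) = cst 0).
    exact: is_derive_cst.
  by apply/funext => t; rewrite eval20.
- move=> c _; rewrite map_polyC /= !derivC polyC0 !eval20 mul0r addr0.
  rewrite (_ : (fun _ => _) = cst c); first exact: is_derive_cst.
  by apply/funext => t; rewrite eval2C hornerC.
- move=> p; rewrite !map_polyC /= !derivC !eval20 derivM derivX mulr1.
  rewrite !mul0r !addr0 !eval2C => dp.
  rewrite (_ : (fun _ => _) = (fun t => eval2 p%:P t (w t)) * id); last first.
    by apply/funext => t; rewrite eval2C hornerMX -(eval2C p t (w t)).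
  apply: is_derive_eq.
  rewrite eval2C hornerD hornerM hornerX -![_ *: _]/(_ * _); ring.
- move=> P dP.
  rewrite (_ : (fun _ => _) = (fun t => eval2 P t (w t)) * w); last first.
    by apply/funext => t; rewrite eval2M eval2X.
  have -> : map_poly deriv (P * 'X) = map_poly deriv P * 'X.
    apply/polyP => i; rewrite coef_map !coefMX coef_map /=.
    by case: ifP; rewrite ?deriv0.
  apply: is_derive_eq.
  rewrite derivM derivX mulr1 eval2D !eval2M eval2X -![_ *: _]/(_ * _); ring.
move=> P Q dP dQ; rewrite (_ : (fun _ => _) =
  (fun t => eval2 P t (w t)) + (fun t => eval2 Q t (w t))); last first.
  by apply/funext => t; rewrite eval2D.
apply: is_derive_eq; rewrite raddfD derivD !eval2D /=; ring.
Qed.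

(** Over the complex numbers this is [divided_derivative]. *)
Definition hasse n f : K -> K := fun z => (n`!%:R)^-1 * derive1n n f z.

Lemma hasse0 f z : hasse 0 f z = f z.
Proof. by rewrite /hasse fact0 invr1 mul1r. Qed.

Hypothesis openU : open U.

Lemma eq_derivable f g : (forall z, U z -> f z = g z) ->
  forall z, U z -> derivable f z 1 -> derivable g z 1.
Proof.
move=> fg z Uz; apply: near_eq_derivable.
by apply: filterS (open_nbhs_nbhs (conj openU Uz)) => t; exact: fg.
Qed.

Lemma eq_derive1 f g : (forall z, U z -> f z = g z) ->
  forall z, U z -> derive1 f z = derive1 g z.
Proof.
move=> fg z Uz; rewrite !derive1E; apply: near_eq_derive.
by apply: filterS (open_nbhs_nbhs (conj openU Uz)) => t; exact: fg.
Qed.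

Lemma eq_hasse n f g : (forall z, U z -> f z = g z) ->
  forall z, U z -> hasse n f z = hasse n g z.
Proof.
move=> fg z Uz; rewrite /hasse; congr (_ * _).
elim: n z Uz => [//|n IH] z Uz; rewrite !derive1nS.
exact: eq_derive1 IH _ Uz.
Qed.

Definition differential_ring B : Prop :=
  forall f, B f -> (forall z, U z -> derivable f z 1) /\ B (derive1 f).

Lemma differential_ring_derive1n B n f :
  differential_ring B -> B f -> B (derive1n n f).
Proof. by move=> dB Bf; elim: n => [//|n /dB[]]. Qed.

Lemma is_derive_hasse B n f z : differential_ring B -> B f -> U z ->
  is_derive z (1 : K) (hasse n f) (n.+1%:R * hasse n.+1 f z).
Proof.
move=> dB Bf Uz.
have /dB[/(_ z Uz) fnz _] := differential_ring_derive1n n dB Bf.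
apply: DeriveDef; first exact: derivableM.
by rewrite /hasse deriveMl // -derive1E factS natrM invfM mulrA mulVKf //.
Qed.

Lemma hasseB B n f g z : differential_ring B -> B f -> B g -> U z ->
  hasse n (fun t => f t - g t) z = hasse n f z - hasse n g z.
Proof.
move=> dB Bf Bg; rewrite /hasse -mulrBr => Uz; congr (_ * _).
elim: n z Uz => [//|n IH] z Uz; rewrite !derive1nS (eq_derive1 IH Uz).
have [/(_ z Uz) fz _] := dB _ (differential_ring_derive1n n dB Bf).
have [/(_ z Uz) gz _] := dB _ (differential_ring_derive1n n dB Bg).
by rewrite !derive1E deriveB.
Qed.

Lemma hasse_cst n c z : hasse n.+1 (fun=> c) z = 0.
Proof.
rewrite /hasse derive1Sn (_ : derive1 (fun=> c) = fun=> 0); last first.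
  by apply/funext => t; rewrite derive1_cst.
rewrite (_ : derive1n n _ z = 0) ?mulr0 //.
elim: n z => [//|n IH] z; rewrite derive1nS (_ : derive1n n _ = fun=> 0).
  by rewrite derive1_cst.
exact/funext.
Qed.

(** The Leibniz rule for divided derivatives has no binomial coefficients,
    which keeps everything over Z. *)
Lemma hasseM B n f g z : function_ring B -> differential_ring B ->
  B f -> B g -> U z ->
  hasse n (fun t => f t * g t) z =
  \sum_(i < n.+1) hasse i f z * hasse (n - i) g z.
Proof.
move=> [_ _ _ Bmul] dB Bf Bg; elim: n z => [|n IH] z Uz.
  by rewrite big_ord1 !hasse0.
have n0 : n.+1%:R != 0 :> K by rewrite pnatr_eq0.
apply: (mulfI n0).
have [_ <-] := is_derive_hasse n dB (Bmul _ _ Bf Bg) Uz.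
rewrite -derive1E (eq_derive1 IH Uz) derive1E.
rewrite (_ : (fun _ => _) =
  \sum_(i < n.+1) (hasse i f * hasse (n - i) g)); last first.
  by apply/funext => t; rewrite fct_sumE.
have df (i : 'I_n.+1) := is_derive_hasse i dB Bf Uz.
have dg (i : 'I_n.+1) := is_derive_hasse (n - i) dB Bg Uz.
rewrite derive_val.
transitivity (\sum_(i < n.+2) i%:R * (hasse i f z * hasse (n.+1 - i) g z) +
  \sum_(i < n.+2) (n.+1 - i)%:R * (hasse i f z * hasse (n.+1 - i) g z)).
  rewrite [X in _ = X + _]big_ord_recl /= mul0r add0r.
  rewrite [X in _ = _ + X]big_ord_recr /=.
  rewrite subnn mul0r addr0 -big_split /=; apply: eq_bigr => i _.
  rewrite -![_ *: _]/(_ * _) /= subSS -subSn ?(leq_ord i) //.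
  by rewrite /bump /= add1n; ring.
rewrite -big_split mulr_sumr; apply: eq_bigr => i _ /=.
by rewrite -mulrDl -natrD subnKC // -ltnS.
Qed.

Definition hasse_closed B : set (K -> K) := [set f | forall n, B (hasse n f)].

Lemma hasse_closed_sub B f : function_ring B -> hasse_closed B f -> B f.
Proof. by case=> Bext _ _ _ /(_ 0%N)/Bext; apply=> z _; rewrite hasse0. Qed.

Lemma hasse_closed_cst B c :
  function_ring B -> B (fun=> c) -> hasse_closed B (fun=> c).
Proof.
move=> rB Bc [|n]; case: (rB) => Bext _ _ _.
  by apply: Bext Bc _ => z _; rewrite hasse0.
by apply: Bext (function_ring0 rB) _ => z _; rewrite hasse_cst.
Qed.

Lemma hasse_id n z : hasse n.+2 (id : K -> K) z = 0.
Proof.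
rewrite /hasse derive1Sn (_ : derive1 id = fun=> 1); last first.
  by apply/funext => t; rewrite derive1E derive_id.
have := hasse_cst n 1 z; rewrite /hasse => /eqP.
rewrite mulf_eq0 invr_eq0 pnatr_eq0 eqn0Ngt fact_gt0 /= => /eqP ->.
by rewrite mulr0.
Qed.

Lemma hasse_closed_id B : function_ring B -> B id -> hasse_closed B id.
Proof.
move=> rB BX [|[|n]]; case: (rB) => Bext B1 _ _.
- by apply: Bext BX _ => z _; rewrite hasse0.
- apply: Bext B1 _ => z _.
  by rewrite /hasse derive1n1 derive1E derive_id invr1 mul1r.
by apply: Bext (function_ring0 rB) _ => z _; rewrite hasse_id.
Qed.

Lemma hasse_closed_ring B : function_ring B -> differential_ring B ->
  function_ring (hasse_closed B).
Proof.
move=> rB dB; have [Bext B1 Bsub Bmul] := rB; split.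
- by move=> f g Hf fg n; apply: Bext (Hf n) _; exact: eq_hasse.
- exact: hasse_closed_cst.
- move=> f g Hf Hg n; apply: Bext (Bsub _ _ (Hf n) (Hg n)) _ => z Uz.
  by rewrite (hasseB n dB) //; exact: hasse_closed_sub.
move=> f g Hf Hg n.
have := @function_ring_sum B _ (index_enum 'I_n.+1) xpredT
  (fun i z => hasse i f z * hasse (n - i) g z) rB.
move=> /(_ (fun i _ => Bmul _ _ (Hf i) (Hg (n - i)%N))) Bsum.
apply: Bext Bsum _ => z Uz.
by rewrite (hasseM n rB dB) //; exact: hasse_closed_sub.
Qed.

(** In the Leibniz expansion of the n-th divided derivative of a product of
    several copies of w, the n-th divided derivative of w occurs only next to
    undifferentiated factors. This gives a chain rule modulo the lower divided
    derivatives of w. *)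
Lemma hasse_eval2 B w n P : (0 < n)%N ->
  function_ring B -> differential_ring B -> B id -> B w ->
  (forall k, (k < n)%N -> B (hasse k w)) -> has_constants B P ->
  B (fun z => hasse n (fun t => eval2 P t (w t)) z -
              eval2 P^`() z (w z) * hasse n w z).
Proof.
move=> n0 rB dB BX Bw Bwk.
pose F P t := eval2 P t (w t).
have [Bext B1 Bsub Bmul] := rB.
have HrB := hasse_closed_ring rB dB.
have [Hext H1 Hsub Hmul] := HrB.
have HX := hasse_closed_id rB BX.
(* The induction on P through the Leibniz rule also needs the lower divided
   derivatives of P(z,w). *)
pose T P := [/\ B (F P), B (F P^`()), forall k, (k < n)%N -> B (hasse k (F P)) &
   B (fun z => hasse n (F P) z - F P^`() z * hasse n w z)].
suff: forall P, has_constants B P -> T P by move=> S /S[].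
(* A polynomial in z alone is handled by the ring of all functions whose divided
   derivatives lie in B. *)
have TC c : has_constants B c%:P -> T c%:P.
  move=> Bc; have Hc : hasse_closed B (F c%:P).
    have := @function_ring_eval2 (hasse_closed B) id c%:P HrB.
    move=> /(_ (fun i j => hasse_closed_cst rB (Bc i j)) HX HX) /Hext; apply.
    by move=> z _; rewrite /F !eval2C.
  split=> //; first exact: hasse_closed_sub.
    apply: Bext (function_ring0 rB) _ => z Uz.
    by rewrite /F derivC eval20.
  apply: Bext (Hc n) _ => z _.
  by rewrite /F derivC eval20 mul0r subr0.
have TD P' Q' : T P' -> T Q' -> T (P' + Q').
  move=> [BP BP' BPk BPn] [BQ BQ' BQk BQn].
  have FD S1 S2 : F (S1 + S2) = fun t => F S1 t - (0 - F S2 t).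
    by apply/funext => t; rewrite /F eval2D sub0r opprK.
  have B0 := function_ring0 rB.
  have hD k z : U z -> hasse k (F (P' + Q')) z =
      hasse k (F P') z + hasse k (F Q') z.
    move=> Uz; rewrite FD (hasseB k dB) // ?(hasseB k dB) //; last exact: Bsub.
    case: k => [|k]; first by rewrite !hasse0; ring.
    by rewrite hasse_cst; ring.
  split.
  - by rewrite FD; apply: (Bsub) => //; exact: Bsub.
  - by rewrite derivD FD; apply: (Bsub) => //; exact: Bsub.
  - move=> k kn; apply: Bext (function_ringD rB (BPk k kn) (BQk k kn)) _.
    by move=> z Uz; rewrite hD.
  apply: Bext (function_ringD rB BPn BQn) _ => z Uz.
  by rewrite hD // /F derivD eval2D; ring.
have TM P' : T P' -> T (P' * 'X).
  move=> [BP BP' BPk BPn].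
  have FM S : F (S * 'X) = fun t => F S t * w t.
    by apply/funext => t; rewrite /F eval2M eval2X.
  have Bsum k :
      (forall i : 'I_k.+1, B (fun z => hasse i (F P') z * hasse (k - i) w z)) ->
      B (hasse k (F (P' * 'X))).
    move=> Bi.
    have := @function_ring_sum B _ (index_enum 'I_k.+1) xpredT _ rB
      (fun i _ => Bi i).
    move=> /Bext; apply=> z Uz; rewrite FM.
    by rewrite (hasseM k rB dB).
  have FM' : F (P' * 'X)^`() = fun t => F P'^`() t * w t + F P' t.
    by apply/funext => t; rewrite /F derivM derivX mulr1 eval2D eval2M eval2X.
  split.
  - by rewrite FM; exact: Bmul.
  - by rewrite FM'; apply: function_ringD => //; exact: Bmul.
  - move=> k kn; apply: Bsum => i; apply: Bmul.
      by apply: BPk; rewrite (leq_ltn_trans _ kn) // -ltnS.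
    by apply: Bwk; rewrite (leq_ltn_trans _ kn) // leq_subr.
  move: Bwk BPk BPn; rewrite -(prednK n0); move: n.-1 => m Bwk BPk BPn.
  have Bi (i : 'I_m) : B (fun z => hasse i.+1 (F P') z * hasse (m - i) w z).
    apply: Bmul; first by apply: BPk; rewrite ltnS.
    by apply: Bwk; rewrite ltnS leq_subr.
  have Bmid := @function_ring_sum B _ (index_enum 'I_m) xpredT _ rB
    (fun i _ => Bi i).
  apply: Bext (function_ringD rB Bmid (Bmul _ _ BPn Bw)) _ => z Uz.
  rewrite FM (hasseM _ rB dB) // big_ord_recl big_ord_recr /=.
  rewrite subn0 subnn !hasse0 FM'.
  ring.
elim/poly_ind => [|P' c IH] BP.
  by rewrite -polyC0; apply: TC; rewrite polyC0.
apply: TD.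
  by apply/TM/IH => i j; have := BP i.+1 j; rewrite coefD coefMX coefC addr0.
apply: TC => i j; rewrite coefC; have [_|_] := eqVneq i 0%N.
  by have := BP 0 j; rewrite coefD coefMX coefC add0r.
by rewrite coef0; exact: function_ring0.
Qed.

(** Differentiating n times the relation Q(z,w) = 0 expresses the n-th divided
    derivative of w through lower ones, at the cost of the denominator
    Q_w(z,w) only; no factorial needs to be inverted. *)
Lemma hasse_closed_etale B Q w v : function_ring B -> differential_ring B ->
  has_constants B Q -> B id -> B w -> B v ->
  (forall z, U z -> eval2 Q z (w z) = 0) ->
  (forall z, U z -> eval2 Q^`() z (w z) * v z = 1) ->
  hasse_closed B w /\ hasse_closed B v.
Proof.
move=> rB dB BQ BX Bw Bv Qw Dv.
have [Bext B1 Bsub Bmul] := rB.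
have B0 := function_ring0 rB.
have Hw : hasse_closed B w.
  move=> n; have [m] := ubnP n; elim: m n => // m IH n nm.
  case: n nm => [|n] nm; first by apply: Bext Bw _ => z _; rewrite hasse0.
  have := @hasse_eval2 B w n.+1 Q isT rB dB BX Bw.
  move=> /(_ (fun k kn => IH k (leq_trans kn nm)) BQ) BS.
  apply: Bext (Bmul _ _ (Bsub _ _ B0 BS) Bv) _ => z Uz.
  rewrite (@eq_hasse _ _ (fun=> 0)) // hasse_cst !sub0r opprK.
  by rewrite mulrAC Dv // mul1r.
split=> //.
pose D z := eval2 Q^`() z (w z).
have HrB := hasse_closed_ring rB dB.
have HD : hasse_closed B D.
  apply: (@function_ring_eval2 _ w Q^`() HrB) => //; last first.
    exact: hasse_closed_id.
  by move=> i j; apply: hasse_closed_cst => //; exact: has_constants_deriv.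
move=> n; have [m] := ubnP n; elim: m n => // m IH n nm.
case: n nm => [|n] nm; first by apply: Bext Bv _ => z _; rewrite hasse0.
have Bi (i : 'I_n.+1) : B (fun z => hasse i.+1 D z * hasse (n - i) v z).
  apply: Bmul; first exact: HD.
  by apply: IH; rewrite -ltnS (leq_ltn_trans _ nm) // ltnS leq_subr.
have Bs := @function_ring_sum B _ (index_enum 'I_n.+1) xpredT _ rB
  (fun i _ => Bi i).
apply: Bext (Bmul _ _ (Bsub _ _ B0 Bs) Bv) _ => z Uz.
have := hasseM n.+1 rB dB (hasse_closed_sub rB HD) Bv Uz.
rewrite (@eq_hasse _ _ (fun=> 1)) // hasse_cst big_ord_recl hasse0 subn0.
move=> /eqP; rewrite eq_sym addr_eq0 => /eqP E.
by rewrite sub0r -[RHS](mul1r) -(Dv z Uz) -/(D z) mulrAC E.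
Qed.

Definition generates (G B : set (K -> K)) : Prop :=
  G `<=` B /\ forall B', function_ring B' -> G `<=` B' -> B `<=` B'.

(** The relation Q_z(z,w) + Q_w(z,w) w' = 0 gives w', as v is the inverse of
    Q_w(z,w); then v' = - v^2 (Q_w(z,w))'. *)
Lemma etale_differential B Q w v : function_ring B ->
  generates ([set id; w; v] `|`
    [set f | exists2 c, B (fun=> c) & f = fun=> c]) B ->
  has_constants B Q ->
  (forall z, U z -> derivable w z 1) ->
  (forall z, U z -> eval2 Q z (w z) = 0) ->
  (forall z, U z -> eval2 Q^`() z (w z) * v z = 1) ->
  differential_ring B.
Proof.
move=> rB [GB Bgen] BQ dw Qw Dv.
have [Bext B1 Bsub Bmul] := rB; have B0 := function_ring0 rB.
pose B' : set (K -> K) :=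
  [set f | [/\ B f, forall z, U z -> derivable f z 1 & B (derive1 f)]].
suff BB' : B `<=` B' by move=> f /BB'[].
have BX : B id by apply: GB; left; left; left.
have Bw : B w by apply: GB; left; left; right.
have Bv : B v by apply: GB; left; right.
have rB' : function_ring B'.
  split.
  - move=> f g [Bf df Bdf] fg; split; first exact: Bext Bf fg.
      by move=> z Uz; exact: eq_derivable fg _ Uz (df z Uz).
    by apply: Bext Bdf _; exact: eq_derive1.
  - split=> //.
    by apply: Bext B0 _ => z _; rewrite derive1_cst.
  - move=> f g [Bf df Bdf] [Bg dg Bdg]; split; first exact: Bsub.
      by move=> z Uz; apply: derivableB; [exact: df|exact: dg].
    apply: Bext (Bsub _ _ Bdf Bdg) _ => z Uz.
    by rewrite !derive1E deriveB //; [exact: df|exact: dg].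
  move=> f g [Bf df Bdf] [Bg dg Bdg]; split; first exact: Bmul.
    by move=> z Uz; apply: derivableM; [exact: df|exact: dg].
  apply: Bext (function_ringD rB (Bmul _ _ Bf Bdg) (Bmul _ _ Bg Bdf)) _ => z Uz.
  by rewrite !derive1E deriveM //; [exact: df|exact: dg].
have B'c c : B (fun=> c) -> B' (fun=> c).
  move=> Bc; split=> //.
  by apply: Bext B0 _ => z _; rewrite derive1_cst.
have B'X : B' id.
  split=> //.
  by apply: Bext B1 _ => z _; rewrite derive1E derive_id.
have B'w : B' w.
  split=> //.
  have BQz := function_ring_eval2 rB (has_constants_map_deriv rB BQ) BX Bw.
  apply: Bext (Bmul _ _ (Bsub _ _ B0 BQz) Bv) _ => z Uz.
  have /derivableP dwz := dw z Uz.
  have := eq_derive1 Qw Uz; rewrite derive1_cst derive1E.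
  have [_ ->] := is_derive_eval2 Q dwz => /eqP.
  rewrite addrC addr_eq0 => /eqP DE.
  by rewrite sub0r -DE mulrAC Dv // mul1r derive1E.
apply: Bgen => // f [[[->|->]|->]|[c Bc ->]] //; last exact: B'c.
have [BD dD BdD] : B' (fun z => eval2 Q^`() z (w z)).
  apply: function_ring_eval2 => // i j; apply: B'c.
  exact: has_constants_deriv.
have D0 z : U z -> eval2 Q^`() z (w z) != 0.
  move=> Uz; apply: contra_eqN (Dv z Uz) => /eqP ->.
  by rewrite mul0r eq_sym oner_eq0.
have vE z : U z -> (eval2 Q^`() z (w z))^-1 = v z.
  by move=> Uz; apply: (mulfI (D0 z Uz)); rewrite divff ?D0 // Dv.
split=> //.
  move=> z Uz; apply: (eq_derivable vE Uz).
  by apply: (@derivableV _ _ (fun z => eval2 Q^`() z (w z)));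
    [exact: D0|exact: dD].
apply: Bext (Bmul _ _ (Bmul _ _ (Bsub _ _ B0 Bv) Bv) BdD) _ => z Uz.
rewrite -(eq_derive1 vE Uz) !derive1E deriveV ?D0 //; last exact: dD.
by rewrite -vE // expr2 invfM sub0r mulNr scaleNr mulNr.
Qed.

Lemma etale_hasse_closed B Q w v : function_ring B ->
  generates ([set id; w; v] `|`
    [set f | exists2 c, B (fun=> c) & f = fun=> c]) B ->
  has_constants B Q ->
  (forall z, U z -> derivable w z 1) ->
  (forall z, U z -> eval2 Q z (w z) = 0) ->
  (forall z, U z -> eval2 Q^`() z (w z) * v z = 1) ->
  forall f n, B f -> B (hasse n f).
Proof.
move=> rB gB BQ dw Qw Dv f n Bf; move: n.
have dB := etale_differential rB gB BQ dw Qw Dv.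
have [GB Bgen] := gB.
have BX : B id by apply: GB; left; left; left.
have Bw : B w by apply: GB; left; left; right.
have Bv : B v by apply: GB; left; right.
have [Hw Hv] := hasse_closed_etale rB dB BQ BX Bw Bv Qw Dv.
apply: (Bgen _ (hasse_closed_ring rB dB)) Bf.
move=> g [[[->|->]|->]|[c Bc ->]] //.
  exact: hasse_closed_id.
exact: hasse_closed_cst.
Qed.

End FunctionRings.

(** * The algebra of an etale curve *)

Section GeneratedAlgebra.
Variables (R : realType) (U : set (Cplx R)).
Variables (N : nat) (x : 'I_N -> Cplx R -> Cplx R).

Lemma generated_algebra_ring : function_ring U (generated_algebra U x).
Proof.
split.
- by move=> f g [p fp] fg; exists p => z Uz; rewrite -fg // fp.
- by exists 1 => z _; rewrite rmorph1.
- move=> f g [p fp] [q gq]; exists (p - q) => z Uz.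
  by rewrite rmorphB /= fp // gq.
- move=> f g [p fp] [q gq]; exists (p * q) => z Uz.
  by rewrite rmorphM /= fp // gq.
Qed.

Lemma generated_algebra_generates :
  generates U (range x) (generated_algebra U x).
Proof.
split.
  move=> _ [i _ <-]; exists (mpolyX _ (mnm1 i)) => z Uz.
  by rewrite mmapX mmap1U.
move=> B' rB' xB' f [p fp]; have [Bext B1 Bsub Bmul] := rB'.
have B0 := function_ring0 rB'.
have Bnat n : B' (fun=> n%:R).
  elim: n => [|n IH]; first exact: B0.
  by apply: Bext (function_ringD rB' B1 IH) _ => z _; rewrite -natr1 addrC.
have Bint k : B' (fun=> k%:~R).
  case: k => n; first exact: Bnat.
  by apply: Bext (Bsub _ _ B0 (Bnat n.+1)) _ => z _; rewrite sub0r NegzE mulrNz.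
have Bexp g n : B' g -> B' (fun z => g z ^+ n).
  move=> Bg; elim: n => [|n IH]; first exact: B1.
  by apply: Bext (Bmul _ _ Bg IH) _ => z _; rewrite exprS.
have Bprod (r : seq 'I_N) (m : multinom N) :
    B' (fun z => \prod_(i <- r) x i z ^+ m i).
  elim: r => [|i r IH].
    by apply: Bext B1 _ => z _; rewrite big_nil.
  have Bx : B' (x i) by apply: xB'; exists i.
  by apply: Bext (Bmul _ _ (Bexp _ (m i) Bx) IH) _ => z _; rewrite big_cons.
have Bp := @function_ring_sum _ U B' _ (msupp p) xpredT _ rB'
  (fun m _ => Bmul _ _ (Bint (mcoeff m p)) (Bprod (index_enum 'I_N) m)).
by apply: Bext Bp _ => z Uz; rewrite fp.
Qed.

End GeneratedAlgebra.

(** Adjoining the coefficients of S puts S(z,w) in the algebra and does not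
    affect integrality, since the divided derivatives of a constant vanish. *)
Lemma etale_integral_function (R : realType) (U : set (Cplx R))
    (w v : Cplx R -> Cplx R) (Q S : {poly {poly (Cplx R)}}) :
  open U -> holomorphic U w ->
  (forall z, U z -> eval2 Q z (w z) = 0) ->
  (forall z, U z -> eval2 Q^`() z (w z) * v z = 1) ->
  integral_function U (fun z => eval2 S z (w z)).
Proof.
move=> openU dw Qw Dv.
pose coefs (P : {poly {poly (Cplx R)}}) := flatten [seq polyseq p | p <- P].
pose cs := coefs Q ++ coefs S.
pose gens : seq (Cplx R -> Cplx R) := [:: id; w; v] ++ [seq cst c | c <- cs].
pose x (i : 'I_(size gens)) := nth w gens i.
have gP f : f \in gens -> range x f.
  move=> fg; have ig : (index f gens < size gens)%N by rewrite index_mem.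
  by exists (Ordinal ig) => //; rewrite /x /= nth_index.
have rB := generated_algebra_ring U x.
have [xB Bgen] := generated_algebra_generates U x.
have Bx f : f \in gens -> generated_algebra U x f by move=> /gP/xB.
have Bc c : c \in cs -> generated_algebra U x (fun=> c).
  by move=> ccs; apply: Bx; rewrite mem_cat (map_f cst ccs) orbT.
have Bcoefs P : {subset coefs P <= cs} ->
    has_constants (generated_algebra U x) P.
  move=> Pcs i j; have [Pi|Pi] := leqP (size P) i.
    have -> : P`_i = 0 by rewrite nth_default.
    by rewrite coef0; exact: function_ring0 rB.
  have [Pij|Pij] := leqP (size P`_i) j.
    by rewrite nth_default //; exact: function_ring0 rB.
  apply/Bc/Pcs/flattenP; exists (polyseq P`_i); last exact: mem_nth.
  by apply: map_f; exact: mem_nth.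
have BQ : has_constants (generated_algebra U x) Q.
  by apply: Bcoefs => c; rewrite mem_cat => ->.
have BS : has_constants (generated_algebra U x) S.
  by apply: Bcoefs => c; rewrite mem_cat orbC => ->.
have Bid : generated_algebra U x id by apply: Bx; rewrite mem_head.
have Bw : generated_algebra U x w by apply: Bx; rewrite !inE eqxx orbT.
have Bv : generated_algebra U x v by apply: Bx; rewrite !inE eqxx !orbT.
have gB : generates U ([set id; w; v] `|`
    [set f | exists2 c, generated_algebra U x (fun=> c) & f = fun=> c])
    (generated_algebra U x).
  split; first by move=> f [[[->|->]|->]|[c Bc' ->]].
  move=> B' rB' GB'; apply: Bgen => // _ [i _ <-]; apply: GB'.
  have : x i \in gens by exact: mem_nth.
  rewrite mem_cat !inE => /orP[/or3P[]/eqP ->|/mapP[c ccs ->]].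
  - by left; left; left.
  - by left; left; right.
  - by left; right.
  by right; exists c => //; exact: Bc.
exists (size gens), x; split; last exact: function_ring_eval2 rB BS Bid Bw.
split=> [i|f n Bf]; last exact: (etale_hasse_closed openU rB gB BQ dw Qw Dv).
have dB := etale_differential openU rB gB BQ dw Qw Dv.
by have [] := dB (x i) (xB (x i) (ex_intro2 _ _ i I erefl)).
Qed.

(** * Limits of algebraic functions *)

Section Topology.
Variable R : realType.
Local Notation K := (Cplx R).

Lemma continuous_real_complex : continuous (real_complex R : R -> K).
Proof.
move=> t; apply/cvgrPdist_lt => e e0.
have eE : real_complex R (complex.Re e) = e by exact/RRe_real/gtr0_real.
near=> s.
rewrite -[_ t - _ s]rmorphB -eE normc_def /= expr0n addr0 sqrtr_sqr ltcR.
near: s; apply: cvgr_dist_lt => //; by rewrite -ltcR eE.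
Unshelve. all: by end_near. Qed.

Lemma connected_segment (a b : K) :
  connected [set a + real_complex R t * (b - a) | t in `[0, 1]%classic].
Proof.
apply: connected_continuous_connected; first exact: segment_connected.
apply: continuous_subspaceT => t.
apply: cvgD; first exact: cvg_cst.
by apply: cvgM; [exact: continuous_real_complex|exact: cvg_cst].
Qed.

Definition punctured_disc (r : K) : set K := [set z | 0 < `|z| < r].

Lemma connected_star (S : set K) (a : K) : S a ->
  (forall z (t : R), S z -> 0 <= t <= 1 -> S (a + real_complex R t * (z - a))) ->
  connected S.
Proof.
move=> Sa Sstar.
have -> : S = \bigcup_(z in S)
    [set a + real_complex R t * (z - a) | t in `[0, 1]%classic].
  apply/seteqP; split => [z Sz|z [b Sb [t t01 <-]]].
    exists z => //; exists 1; first by rewrite /= in_itv /= ler01 lexx.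
    by rewrite rmorph1 mul1r addrC subrK.
  by apply: Sstar => //; move: t01; rewrite /= in_itv.
apply: bigcup_connected => [|z Sz]; last exact: connected_segment.
exists a => z Sz; exists 0; first by rewrite /= in_itv /= ler01 lexx.
by rewrite rmorph0 mul0r addr0.
Qed.

(** The disc slit along the half-line opposite to a is star-shaped about a. *)
Lemma connected_slit_disc (r a : K) : a != 0 -> `|a| < r ->
  connected [set z | 0 < `|z| < r /\ ~~ (z / a <= 0)].
Proof.
move=> a0 ar; apply: (@connected_star _ a).
  by split; [rewrite normr_gt0 a0 ar|rewrite divff // ler10].
move=> z t [/andP[z0 zr] za] /andP[t0 t1].
set c := a + _.
have cE : c / a = (1 - real_complex R t) + real_complex R t * (z / a).
  by rewrite /c; field.
have tC0 : 0 <= real_complex R t :> K by rewrite ler0c.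
have tC1 : real_complex R t <= 1 :> K by rewrite -lecR in t1.
have ca : ~~ (c / a <= 0).
  apply: contra za => ca; have [t00|t_neq0] := eqVneq (real_complex R t) 0.
    by move: ca; rewrite cE t00 subr0 mul0r addr0 ler10.
  have -> : z / a = (c / a - (1 - real_complex R t)) / real_complex R t.
    by rewrite cE; field; rewrite t_neq0.
  rewrite pmulr_lle0 ?invr_gt0 ?lt0r ?t_neq0 //.
  by rewrite subr_le0 (le_trans ca) // subr_ge0.
split=> //; rewrite normr_gt0; apply/andP; split.
  by apply: contraNneq ca => ->; rewrite mul0r.
have [tC1'|t_neq1] := eqVneq (real_complex R t) 1.
  by rewrite /c tC1' mul1r addrC subrK.
have -> : c = (1 - real_complex R t) * a + real_complex R t * z.
  by rewrite /c; ring.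
have tC1' : 0 < 1 - real_complex R t by rewrite subr_gt0 lt_neqAle t_neq1.
have -> : r = (1 - real_complex R t) * r + real_complex R t * r by ring.
apply: le_lt_trans (ler_normD _ _) _.
rewrite !normrM (gtr0_norm tC1') (ger0_norm tC0).
by rewrite ltr_leD ?ltr_pM2l ?ler_wpM2l // ltW.
Qed.

(** The disc slit along a radius and the disc slit along the opposite radius
    overlap and cover the punctured disc. *)
Lemma connected_punctured_disc (r : K) : 0 < r -> connected (punctured_disc r).
Proof.
move=> r0; pose a := r / 2.
have a0 : 0 < a by rewrite divr_gt0.
have a_neq0 : a != 0 by rewrite gt_eqF.
have ar : a < r by rewrite ltr_pdivrMr // ltr_pMr // ltr1n.
have -> : punctured_disc r =
    [set z | 0 < `|z| < r /\ ~~ (z / a <= 0)] `|`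
    [set z | 0 < `|z| < r /\ ~~ (z / - a <= 0)].
  apply/seteqP; split => [z zr|z [] [] //].
  have [za|za] := boolP (z / a <= 0); last by left.
  right; split=> //; apply/negP; rewrite invrN mulrN oppr_le0 => za'.
  have : z / a = 0 by apply/eqP; rewrite eq_le za za'.
  move/eqP; rewrite mulf_eq0 invr_eq0 (negPf a_neq0) orbF => /eqP z0.
  by move: zr; rewrite /punctured_disc /= z0 normr0 ltxx.
apply: connectedU; last 2 first.
- by apply: connected_slit_disc => //; rewrite gtr0_norm.
- by apply: connected_slit_disc; rewrite ?oppr_eq0 // normrN gtr0_norm.
pose i : K := (0 +i* 1)%C.
have iE : `|i| = 1 by rewrite normc_def /= expr0n expr1n add0r sqrtr1.
exists (i * a).
have ia : 0 < `|i * a| < r by rewrite normrM iE mul1r gtr0_norm // a0.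
rewrite /= invrN mulrN -mulrA divff // mulr1 lecE oppr_le0 lecE /=.
by rewrite eq_sym oner_eq0.
Qed.

Lemma near_dnbhs0 (S : K -> Prop) :
  (\forall z \near 0^', S z) <->
  exists2 r : K, 0 < r & forall z, punctured_disc r z -> S z.
Proof.
split.
  move=> /nbhs_ballP[r /= r0 rS]; exists r => // z /andP[z0 zr].
  by apply: rS; [rewrite -ball_normE /= sub0r normrN|rewrite -normr_gt0].
case=> r r0 rS; apply/nbhs_ballP; exists r => // z /=.
rewrite -ball_normE /= sub0r normrN => zr z0.
by apply: rS; rewrite /punctured_disc /= normr_gt0 z0.
Qed.

Lemma near_dnbhs0_norm_lt (e : K) :
  0 < e -> \forall z \near (0 : K)^', `|z| < e.
Proof. by move=> e0; apply/near_dnbhs0; exists e => // z /andP[]. Qed.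

Lemma open_punctured_disc (r : K) : open (punctured_disc r).
Proof.
rewrite openE => z /andP[z0 zr]; rewrite /interior /punctured_disc /=.
have zr0 : 0 < r - `|z| by rewrite subr_gt0.
near=> t.
have t0 : `|z - t| < `|z| by near: t; exact: cvgr_dist_lt.
have tr : `|z - t| < r - `|z| by near: t; exact: cvgr_dist_lt.
apply/andP; split.
  by rewrite normr_gt0; apply: contraTneq t0 => ->; rewrite subr0 ltxx.
have -> : t = z - (z - t) by rewrite subKr.
by rewrite (le_lt_trans (ler_normB _ _)) // -ltrBrDl.
Unshelve. all: by end_near. Qed.

Lemma positive_lower_bound (s : seq K) : {in s, forall x, 0 < x} ->
  exists2 d : K, 0 < d & {in s, forall x, d <= x}.
Proof.
elim: s => [_|a s IH s0]; first by exists 1.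
have [|d d0 ds] := IH; first by move=> x xs; apply: s0; rewrite inE xs orbT.
have a0 : 0 < a by apply: s0; rewrite mem_head.
have [da|ad] := real_leP (gtr0_real d0) (gtr0_real a0).
  by exists d => // x; rewrite inE => /predU1P[->|/ds].
exists a => // x; rewrite inE => /predU1P[->//|/ds]; exact/le_trans/ltW.
Qed.

Lemma separated_points (s : seq K) : exists2 d : K, 0 < d &
  {in s &, forall a b, `|a - b| < d -> a = b}.
Proof.
pose ds := [seq `|ab.1 - ab.2| |
  ab <- [seq (a, b) | a <- s, b <- s] & ab.1 != ab.2].
have [|d d0 dP] := @positive_lower_bound ds.
  move=> x /mapP[[a b]]; rewrite mem_filter /= => /andP[ab _] ->.
  by rewrite normr_gt0 subr_eq0.
exists d => // a b sa sb abd; apply/eqP; apply: contraTT abd => ab.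
have /dP dab : `|a - b| \in ds.
  apply/mapP; exists (a, b) => //; rewrite mem_filter /= ab.
  by apply/allpairsP; exists (a, b).
by rewrite le_gtF.
Qed.

Lemma near_root (p : {poly K}) : p != 0 -> exists s : seq K,
  forall e : K, 0 < e -> exists2 d : K, 0 < d &
  forall w, `|p.[w]| < d -> exists2 a, a \in s & `|w - a| < e.
Proof.
move=> p0; have [s pE] := @closed_field_poly_normal (complex R) p.
exists s => e e0; exists (`|lead_coef p| * e ^+ size s).
  by rewrite mulr_gt0 ?exprn_gt0 // normr_gt0 lead_coef_eq0.
move=> w; rewrite {1}pE hornerZ normrM ltr_pM2l ?normr_gt0 ?lead_coef_eq0 //.
elim: s {pE} => [|a s IH]; first by rewrite big_nil hornerC normr1 expr0 ltxx.
rewrite big_cons hornerM hornerXsubC normrM exprS => ws.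
have [wa|wa] := real_ltP (normr_real (w - a)) (gtr0_real e0).
  by exists a => //; rewrite mem_head.
have [|b bs wb] := IH; last by exists b => //; rewrite inE bs orbT.
rewrite -(ltr_pM2l e0); apply: le_lt_trans ws.
by rewrite ler_wpM2r.
Qed.

Lemma eval2_bounded (P : {poly {poly K}}) (M : K) :
  exists2 B : K, 0 < B &
    forall z y, `|z| <= 1 -> `|y| <= M -> `|eval2 P z y| <= B.
Proof.
have [M0|/negbTE M0] := boolP (0 <= M); last first.
  by exists 1 => // z y _ /(le_trans (normr_ge0 y)); rewrite M0.
elim/poly_ind: P => [|P p [B B0 PB]].
  by exists 1 => // z y _ _; rewrite eval20 normr0.
have [C C0 pC] : exists2 C : K, 0 < C & forall z, `|z| <= 1 -> `|p.[z]| <= C.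
  elim/poly_ind: p => [|p c [C C0 pC]].
    by exists 1 => // z _; rewrite horner0 normr0.
  exists (C + `|c|) => [|z z1]; first by rewrite ltr_wpDr.
  rewrite hornerMXaddC (le_trans (ler_normD _ _)) //.
  by rewrite lerD2r normrM -[C]mulr1 ler_pM // pC.
exists (B * M + C) => [|z y z1 yM]; first by rewrite ltr_wpDl // mulr_ge0 // ltW.
rewrite eval2D eval2M eval2X eval2C (le_trans (ler_normD _ _)) // lerD ?pC //.
by rewrite normrM ler_pM // PB.
Qed.

(** Divide P by a power of z so that P(0,.) is nonzero. Near the puncture the
    values of w cluster around the finitely many roots of P(0,.), and by
    connectedness of the punctured disc they all cluster around one root. *)
Lemma algebraic_limit (P : {poly {poly K}}) (w : K -> K) (M : K) :
  P != 0 -> (\forall z \near (0 : K)^', eval2 P z (w z) = 0) ->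
  (\forall z \near (0 : K)^', {for z, continuous w}) ->
  (\forall z \near (0 : K)^', `|w z| <= M) ->
  exists l : K, w @ (0 : K)^' --> l.
Proof.
move=> P0 Pw wC wM.
have [n [Q [PQ Q0]]] := specialize_factor 0 P0.
set p := specialize 0 Q in Q0.
have Qw : \forall z \near (0 : K)^', eval2 Q z (w z) = 0.
  near=> z; have z0 : z != 0 by near: z; exact: nbhs_dnbhs_neq.
  have : eval2 P z (w z) = 0 by near: z.
  rewrite PQ eval2M eval2C horner_exp hornerXsubC subr0 => /eqP.
  by rewrite mulf_eq0 expf_eq0 (negPf z0) andbF => /eqP.
have [|S QS] := @specialize_eq0 _ 0 (Q - map_poly polyC p).
  rewrite /specialize rmorphB /= -/(specialize 0 Q) -/p -map_poly_comp.
  rewrite map_poly_id ?subrr // => c _ /=.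
  by rewrite /horner_eval hornerC.
have [B B0 SB] := eval2_bounded S M.
have pwS z : `|z| <= 1 -> eval2 Q z (w z) = 0 -> `|w z| <= M ->
    `|p.[w z]| <= `|z| * B.
  move=> z1 Qz Mz; have : eval2 (Q - map_poly polyC p) z (w z) = - p.[w z].
    rewrite eval2D Qz add0r /eval2 hornerN hornerN.
    by rewrite (horner_map polyC) hornerC.
  rewrite QS eval2M eval2C hornerXsubC subr0 => E.
  by rewrite -[`|p.[_]|]normrN -E normrM ler_wpM2l // SB.
have pw (d : K) : 0 < d -> \forall z \near (0 : K)^', `|p.[w z]| < d.
  move=> d0; near=> z.
  have z1 : `|z| < 1 by near: z; exact: near_dnbhs0_norm_lt.
  have zd : `|z| < d / B by near: z; apply: near_dnbhs0_norm_lt; rewrite divr_gt0.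
  rewrite (@le_lt_trans _ _ (`|z| * B)) -?ltr_pdivlMr //.
  by apply: pwS; [exact: ltW|near: z; exact: Qw|near: z; exact: wM].
have [s sP] := near_root Q0.
have [d d0 sd] := separated_points s.
have e0 : 0 < d / 2 by rewrite divr_gt0.
have near_s (e : K) : 0 < e ->
    \forall z \near (0 : K)^', exists2 a, a \in s & `|w z - a| < e.
  by move=> /sP[d' d'0 d'P]; near do apply: d'P; exact: pw.
have : \forall z \near (0 : K)^', {for z, continuous w} /\
    exists2 a, a \in s & `|w z - a| < d / 2.
  by near=> z; split; near: z; [exact: wC|exact: near_s].
move=> /near_dnbhs0[r r0 rP].
have rz : punctured_disc r (r / 2).
  rewrite /punctured_disc /= gtr0_norm ?divr_gt0 //.
  by rewrite ltr_pdivrMr // ltr_pMr // ltr1n.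
have [_ [a sa wa]] := rP _ rz.
have close_roots z b c : b \in s -> c \in s -> `|w z - b| < d / 2 ->
    `|w z - c| < d / 2 -> b = c.
  move=> sb sc wb wc; apply: sd => //.
  have -> : b - c = (w z - c) - (w z - b) by ring.
  rewrite (le_lt_trans (ler_normB _ _)) // [d](splitr d) ltrD //.
have ball_near z (b : K) : punctured_disc r z -> `|w z - b| < d / 2 ->
    \forall t \near z, punctured_disc r t /\ `|w t - b| < d / 2.
  move=> zr wb; have [wz _] := rP _ zr; near=> t; split.
    by near: t; apply: open_nbhs_nbhs; split=> //; exact: open_punctured_disc.
  have wt : `|w z - w t| < d / 2 - `|w z - b|.
    by near: t; move/cvgrPdist_lt: wz; apply; rewrite subr_gt0.
  have -> : w t - b = (w z - b) - (w z - w t) by ring.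
  by rewrite (le_lt_trans (ler_normB _ _)) // -ltrBrDl.
have near_a : punctured_disc r `<=` [set z | `|w z - a| < d / 2].
  have <- : punctured_disc r `&` [set z | `|w z - a| < d / 2] = punctured_disc r.
    apply: (connected_punctured_disc r0); first by exists (r / 2).
      exists (punctured_disc r `&` [set z | `|w z - a| < d / 2]).
        by rewrite openE => z [zr wz]; exact: ball_near.
      by rewrite setIA setIid.
    exists (~` (punctured_disc r `&`
        [set z | exists2 b, b \in s /\ b != a & `|w z - b| < d / 2])).
      apply: open_closedC; rewrite openE => z [zr [b sb wz]].
      by apply: filterS (ball_near z b zr wz) => t [tr wt]; split=> //; exists b.
    apply/seteqP; split=> z [zr /= wz]; split=> //.
      by move=> [_ [b [sb /eqP ba] wb]]; apply: ba; exact: close_roots wb wz.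
    have [_ [b sb wb]] := rP _ zr.
    have [<-//|ba] := eqVneq b a.
    by case: wz; split=> //; exists b.
  by move=> z [].
exists a; apply/cvgrPdist_lt => e e0'.
have [|e' e'0 e'P] := @positive_lower_bound [:: e; d / 2].
  by move=> x; rewrite !inE => /orP[]/eqP->.
near=> z.
have [b sb wb] : exists2 b, b \in s & `|w z - b| < e'.
  by near: z; exact: near_s.
have <- : b = a.
  apply: (@close_roots z) => //.
    by rewrite (lt_le_trans wb) // e'P // !inE eqxx orbT.
  by apply: near_a; near: z; apply/near_dnbhs0; exists r.
by rewrite distrC (lt_le_trans wb) // e'P // !inE eqxx.
Unshelve. all: by end_near.
Qed.

End Topology.

(** * The Newton polygon *)

(** The hypotheses say that two terms of a polynomial in (t^q, y) have
    comparable sizes, for T = |t| and X = |y|. As k - j divides q, they put X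
    within a factor C of a power of T with integral exponent; so if X is much
    smaller than T^m, it is at most of order T^(m+1). *)
Lemma newton_step (K : numFieldType) (X T C d : K) (a b j k q m : nat) :
  0 < X -> 0 < T < 1 -> 1 <= C -> 0 <= d <= 1 -> C * d < 1 ->
  (j < k)%N -> (k - j %| q)%N ->
  X ^+ k * T ^+ (q * a) <= C * (X ^+ j * T ^+ (q * b)) ->
  X ^+ j * T ^+ (q * b) <= C * (X ^+ k * T ^+ (q * a)) ->
  X <= d * T ^+ m -> X <= C * T ^+ m.+1.
Proof.
move=> X0 /andP[T0 T1] C1 /andP[d0 d1] Cd jk eq.
set e := (k - j)%N in eq; have e0 : (0 < e)%N by rewrite subn_gt0.
have -> : k = (j + e)%N by rewrite subnKC // ltnW.
rewrite exprD -!mulrA !(mulrCA C (X ^+ j)) !ler_pM2l ?exprn_gt0 // => XT TX Xd.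
have C0 : 0 < C by rewrite (lt_le_trans _ C1).
have Tlt : T ^+ (q * b) < T ^+ (m * e + q * a).
  apply: le_lt_trans TX _.
  apply: (@le_lt_trans _ _ (C * d * T ^+ (m * e + q * a))); last first.
    by rewrite gtr_pMl // exprn_gt0.
  rewrite -mulrA ler_pM2l // exprD mulrA ler_pM2r ?exprn_gt0 //.
  apply: (@le_trans _ _ ((d * T ^+ m) ^+ e)).
    apply: lerXn2r => //; rewrite nnegrE; first exact: ltW.
    by rewrite mulr_ge0 // exprn_ge0 // ltW.
  rewrite exprMn -exprM ler_pM2r ?exprn_gt0 //.
  by rewrite -(prednK e0) exprS ler_piMr // exprn_ile1.
rewrite ltr_iXn2l // in Tlt.
have le_b : (m.+1 * e + q * a <= q * b)%N.
  have [s qE] := dvdnP eq.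
  by move: Tlt; rewrite qE ![(s * e * _)%N]mulnAC -!mulnDl ltn_pmul2r // leq_pmul2r.
have : X ^+ e <= (C * T ^+ m.+1) ^+ e.
  rewrite exprMn -exprM -(ler_pM2r (exprn_gt0 (q * a) T0)).
  apply: le_trans XT _; rewrite -mulrA -exprD ler_pM //; first exact: ltW.
  - by rewrite ltW // exprn_gt0.
  - by rewrite -(prednK e0) exprS ler_peMr ?exprn_ege1 // ltW.
  by rewrite ler_iXn2l.
by rewrite ler_pXn2r // nnegrE ltW // mulr_gt0 // exprn_gt0.
Qed.

Section Newton.
Variable R : realType.
Local Notation K := (Cplx R).

Lemma continuous_poly (p : {poly K}) : continuous (fun z : K => p.[z]).
Proof.
elim/poly_ind: p => [|p c IH] z.
  have -> : (fun z : K => (0 : {poly K}).[z]) = cst 0.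
    by apply/funext => t; rewrite horner0.
  exact: cst_continuous.
have -> : (fun z : K => (p * 'X + c%:P).[z]) = (fun t => p.[t] * t + c).
  by apply/funext => t; rewrite hornerMXaddC.
rewrite /continuous_at.
have := cvgD (cvgM (IH z) (@cvg_id _ (nbhs z))) (cvg_cst c).
exact.
Qed.

Lemma poly_order (p : {poly K}) : p != 0 -> exists i (A : K), 1 <= A /\
  \forall z \near (0 : K)^',
    `|p.[z]| <= A * `|z| ^+ i /\ `|z| ^+ i <= A * `|p.[z]|.
Proof.
move=> p0; have [i [u u0 pE]] := multiplicity_XsubC p 0.
rewrite p0 /= in u0; exists i.
pose c := `|u.[0]|; have c0 : 0 < c by rewrite normr_gt0.
exists (1 + c *+ 2 + c^-1 *+ 2); split.
  by rewrite -addrA lerDl addr_ge0 // mulrn_wge0 // ?invr_ge0 ltW.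
near=> z.
have uz : `|u.[0] - u.[z]| < c / 2.
  near: z; apply: nbhs_dnbhs; have /cvgrPdist_lt := @continuous_poly u 0.
  by apply; rewrite divr_gt0.
have uz1 : c / 2 <= `|u.[z]|.
  have -> : u.[z] = u.[0] - (u.[0] - u.[z]) by ring.
  apply: le_trans (lerB_dist _ _); rewrite -/c [leLHS](_ : _ = c - c / 2).
    by rewrite lerD2l lerN2 ltW.
  by field.
have uz2 : `|u.[z]| <= c *+ 2.
  have -> : u.[z] = u.[0] - (u.[0] - u.[z]) by ring.
  apply: le_trans (ler_normB _ _) _; rewrite mulr2n lerD2l ltW //.
  by rewrite (lt_trans uz) // ltr_pdivrMr // ltr_pMr // ltr1n.
rewrite pE hornerM horner_exp hornerXsubC subr0 normrM normrX; split.
  apply: ler_wpM2r; first exact: exprn_ge0.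
  apply: le_trans uz2 _; rewrite addrAC lerDr addr_ge0 //.
  by rewrite mulrn_wge0 // invr_ge0 ltW.
rewrite mulrA ler_peMl ?exprn_ge0 //.
rewrite [leLHS](_ : _ = c^-1 *+ 2 * (c / 2)); last by field; rewrite gt_eqF.
have c0' := ltW c0; apply: ler_pM => //.
- by rewrite mulrn_wge0 // invr_ge0.
- by rewrite divr_ge0.
by rewrite lerDr addr_ge0 // mulrn_wge0.
Unshelve. all: by end_near.
Qed.

(** Since the terms of P(z,y) add up to 0, the largest one cannot dominate all
    the others: some other term is at least 1/(n+1) of it, n being the number
    of terms. *)
Lemma newton_pair (P : {poly {poly K}}) : P != 0 ->
  exists (o : nat -> nat) (C : K), 1 <= C /\
  \forall z \near (0 : K)^', forall y, eval2 P z y = 0 -> y != 0 ->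
  exists j k, [/\ (j < k < size P)%N,
    `|y| ^+ k * `|z| ^+ o k <= C * (`|y| ^+ j * `|z| ^+ o j) &
    `|y| ^+ j * `|z| ^+ o j <= C * (`|y| ^+ k * `|z| ^+ o k)].
Proof.
move=> P0; set n := size P.
have /choice[oA oAP] : forall j : nat, exists oA : nat * K, 1 <= oA.2 /\
    (P`_j != 0 -> \forall z \near (0 : K)^',
       `|(P`_j).[z]| <= oA.2 * `|z| ^+ oA.1 /\
       `|z| ^+ oA.1 <= oA.2 * `|(P`_j).[z]|).
  move=> j; have [->|Pj] := eqVneq P`_j 0; first by exists (0%N, 1).
  by have [i [A [A1 iA]]] := poly_order Pj; exists (i, A).
pose o j := (oA j).1.
pose A : K := \sum_(j < n) (oA j).2.
have A_ge j : (j < n)%N -> (oA j).2 <= A.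
  move=> jn; rewrite /A (bigD1 (Ordinal jn)) //= lerDl sumr_ge0 // => i _.
  by rewrite (le_trans ler01) //; have [] := oAP i.
have n0 : (0 < n)%N by rewrite size_poly_gt0.
have A1 : 1 <= A by apply: le_trans (A_ge 0%N n0); have [] := oAP 0%N.
have A0 : 0 < A by exact: lt_le_trans ltr01 A1.
have nA : \forall z \near (0 : K)^', forall j : 'I_n, P`_j != 0 ->
    `|(P`_j).[z]| <= A * `|z| ^+ o j /\ `|z| ^+ o j <= A * `|(P`_j).[z]|.
  apply: filter_forall => j; have [Pj|Pj] := eqVneq P`_j 0; first by near=> z.
  have [_ /(_ Pj) Aj] := oAP j; near=> z => _.
  have [Aj1 Aj2] : `|(P`_j).[z]| <= (oA j).2 * `|z| ^+ o j
       /\ `|z| ^+ o j <= (oA j).2 * `|(P`_j).[z]| by near: z; exact: Aj.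
  by split; [apply: le_trans Aj1 _|apply: le_trans Aj2 _];
    rewrite ler_wpM2r ?exprn_ge0 // A_ge.
exists o, (n.+1%:R * A ^+ 2); split.
  by rewrite mulr_ege1 ?exprn_ege1 // ler1n.
near=> z.
have z0 : z != 0 by near: z; exact: nbhs_dnbhs_neq.
have zA : forall j : 'I_n, P`_j != 0 ->
    `|(P`_j).[z]| <= A * `|z| ^+ o j /\ `|z| ^+ o j <= A * `|(P`_j).[z]|.
  by near: z; exact: nA.
move=> y Py y0.
pose t (j : 'I_n) := (P`_j).[z] * y ^+ j.
have sum_t : \sum_j t j = 0.
  transitivity (eval2 P z y); last exact: Py.
  rewrite /eval2 (horner_coef P) horner_sum; apply: eq_bigr => j _.
  by rewrite hornerM -rmorphXn hornerC.
have t_neq0 (j : 'I_n) : P`_j != 0 -> 0 < `|t j|.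
  move=> Pj; rewrite normr_gt0 mulf_neq0 ?expf_neq0 // -normr_gt0.
  have [_ zPj] := zA j Pj.
  rewrite -(pmulr_rgt0 _ A0) (lt_le_trans _ zPj) // exprn_gt0 //.
  by rewrite normr_gt0.
have last_lt : (n.-1 < n)%N by rewrite prednK.
pose l := Ordinal last_lt.
have Pl : P`_l != 0 by rewrite /= -lead_coefE lead_coef_eq0.
have [k k_max] : exists k, forall j, `|t j| <= `|t k|.
  have [|k _ k_max] := @real_arg_maxP K _ l xpredT (fun j => `|t j|) isT.
    by move=> j _; exact: normr_real.
  by exists k => j; exact: k_max.
have tk0 : 0 < `|t k| by apply: lt_le_trans (t_neq0 _ Pl) (k_max l).
have [j jk tkj] : exists2 j, j != k & `|t k| <= n.+1%:R * `|t j|.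
  apply: contrapT => /forall2NP tk_big; suff: `|t k| < `|t k| by rewrite ltxx.
  have tj_small j : j != k -> `|t j| <= `|t k| / n.+1%:R.
    move=> jk; have [//|] := tk_big j => /negP.
    rewrite -real_ltNge ?realM ?normr_real ?realn // => /ltW.
    by rewrite ler_pdivlMr ?ltr0n // mulrC.
  move/eqP: sum_t; rewrite (bigD1 k) //= addr_eq0 => /eqP tkE.
  rewrite {1}tkE normrN; apply: le_lt_trans (ler_norm_sum _ _ _) _.
  apply: (@le_lt_trans _ _ (\sum_(j < n) `|t k| / n.+1%:R)).
    rewrite [leRHS](bigD1 k) //= -[leLHS]add0r lerD ?divr_ge0 //.
    by apply: ler_sum => j; exact: tj_small.
  rewrite sumr_const card_ord -[ltLHS]mulr_natr -mulrA gtr_pMr //.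
  by rewrite mulrC ltr_pdivrMr ?ltr0n // mul1r ltr_nat.
have tjk := k_max j.
have Pnz (i : 'I_n) : 0 < `|t i| -> P`_i != 0.
  by apply: contraTneq => Pi; rewrite /t Pi horner0 mul0r normr0 ltxx.
have tj0 : 0 < `|t j| by rewrite -(pmulr_rgt0 _ (ltr0Sn _ n)) (lt_le_trans tk0).
pose m (i : 'I_n) := `|y| ^+ i * `|z| ^+ o i.
have tm (i : 'I_n) : 0 < `|t i| -> `|t i| <= A * m i /\ m i <= A * `|t i|.
  move=> /Pnz/zA[zi1 zi2]; rewrite /m /t normrM normrX.
  split; first by rewrite [leLHS]mulrC [leRHS]mulrCA ler_wpM2l ?exprn_ge0.
  by rewrite [leRHS]mulrA [leRHS]mulrC ler_wpM2l ?exprn_ge0.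
have cmp (i i' : 'I_n) :
    0 < `|t i| -> 0 < `|t i'| -> `|t i| <= n.+1%:R * `|t i'| ->
    m i <= n.+1%:R * A ^+ 2 * m i'.
  move=> ti ti' tii'; have [_ mi] := tm i ti; have [mi' _] := tm i' ti'.
  apply: le_trans mi _; have -> : n.+1%:R * A ^+ 2 * m i' =
    A * (n.+1%:R * (A * m i')) by ring.
  rewrite ler_pM2l // (le_trans tii') // ler_wpM2l //.
have tjk' : `|t j| <= n.+1%:R * `|t k|.
  by apply: le_trans tjk _; rewrite ler_peMl // ler1n.
have [jk'|kj|/val_inj jk'] := ltngtP j k; last by rewrite jk' eqxx in jk.
  by exists j, k; split; [rewrite jk' /=|exact: cmp|exact: cmp].
by exists k, j; split; [rewrite kj /=|exact: cmp|exact: cmp].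
Unshelve. all: by end_near.
Qed.

End Newton.

(** * Continuous algebraic functions are differentiable *)

Lemma continuous_div (K : numFieldType) (f g : K -> K) (z : K) :
  {for z, continuous f} -> {for z, continuous g} -> g z != 0 ->
  {for z, continuous (fun t => f t / g t)}.
Proof.
move=> fz gz gz0; exact: (continuousM fz (continuousV gz0 gz)).
Qed.

Section Removable.
Variable R : realType.
Local Notation K := (Cplx R).

Lemma near_dnbhs0_expr (S : K -> Prop) n : (0 < n)%N ->
  (\forall z \near (0 : K)^', S z) -> \forall z \near (0 : K)^', S (z ^+ n).
Proof.
move=> n0 /near_dnbhs0[r r0 rS]; apply/near_dnbhs0.
have [|d d0 dP] := @positive_lower_bound R [:: r; 1].
  by move=> x; rewrite !inE => /orP[]/eqP->.
exists d => // z /andP[z0 zd]; apply: rS.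
have zr : `|z| < r by rewrite (lt_le_trans zd) // dP // !inE eqxx.
have z1 : `|z| < 1 by rewrite (lt_le_trans zd) // dP // !inE eqxx orbT.
rewrite /punctured_disc /= normrX exprn_gt0 //= (le_lt_trans _ zr) //.
by rewrite -(prednK n0) exprS ler_piMr // exprn_ile1 // ltW.
Qed.

Lemma near_dnbhs0_unit (S : K -> Prop) (u : K) : `|u| = 1 ->
  (\forall z \near (0 : K)^', S z) -> \forall z \near (0 : K)^', S (u * z).
Proof.
move=> u1 /near_dnbhs0[r r0 rS]; apply/near_dnbhs0; exists r => // z zr.
by apply: rS; rewrite /punctured_disc /= normrM u1 mul1r.
Qed.

Lemma near_dnbhs0_root (S : K -> Prop) n : (0 < n)%N ->
  (\forall z \near (0 : K)^', S z) ->
  \forall z \near (0 : K)^', exists2 t, t ^+ n = z & S t.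
Proof.
move=> n0 /near_dnbhs0[r r0 rS]; apply/near_dnbhs0.
exists (r ^+ n); first by rewrite exprn_gt0.
move=> z /andP[z0 zr]; pose t := n.-root (z : complex R).
have tE : t ^+ n = z by exact: rootCK.
exists t => //; apply: rS; rewrite /punctured_disc /= normr_gt0.
apply/andP; split.
  apply: contraTneq z0 => t0.
  by rewrite -tE t0 expr0n gtn_eqF // normr0 ltxx.
by rewrite -tE normrX ltr_pXn2r ?nnegrE // ltW in zr.
Qed.

Lemma primitive_root_exists n : (0 < n)%N ->
  exists2 u : K, `|u| = 1 & forall m, (u ^+ m == 1) = (n %| m)%N.
Proof.
move=> n0.
have [s pE] := @closed_field_poly_normal (complex R) ('X^n - 1).
have nR : n%:R != 0 :> complex R by rewrite pnatr_eq0 -lt0n.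
rewrite (monicP _) ?monicXnsubC // scale1r in pE.
have us : uniq s by rewrite -separable_prod_XsubC -pE separable_Xn_sub_1.
have sz : (n <= size s)%N.
  by have := size_XnsubC (1 : complex R) n0; rewrite pE size_prod_XsubC => -[->].
have sn : all n.-unity_root s.
  by apply/allP => u us'; rewrite /root_of_unity pE root_prod_XsubC.
have /hasP[u _ uP] := has_prim_root n0 sn us sz.
have un : u ^+ n = 1 by exact: prim_expr_order.
exists u => [|m]; last by rewrite (prim_order_dvd uP).
by apply/eqP; rewrite -(pexpr_eq1 n0) // -normrX un normr1.
Qed.

Lemma dnbhs0_cvg_unique (g : K -> K) (l l' : K) :
  g @ (0 : K)^' --> l -> g @ (0 : K)^' --> l' -> l = l'.
Proof. exact: (@cvg_unique _ (@norm_hausdorff _ K) (g @ (0 : K)^')). Qed.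

Lemma continuous_expr n : continuous (fun z : K => z ^+ n).
Proof.
have -> : (fun z : K => z ^+ n) = (fun z => 'X^n.[z]).
  by apply/funext => z; rewrite hornerXn.
exact: continuous_poly.
Qed.

(** Substitute z = t^q, where q is divisible by the denominators of all
    Puiseux exponents: v(t) = w(t^q) behaves like an integral power of t. It
    is O(t^m) for m = 0, ..., q by induction. Indeed v / t^m has a limit,
    which is 0 by hypothesis for m = 0, and also for 0 < m < q because
    multiplying t by a primitive q-th root of unity does not change v; and a v
    that is o(t^m) is O(t^(m+1)), its exponent being an integer. *)
Lemma algebraic_vanishing (P : {poly {poly K}}) (w : K -> K) :
  P != 0 -> (\forall z \near (0 : K)^', eval2 P z (w z) = 0) ->
  (\forall z \near (0 : K)^', {for z, continuous w}) ->
  w @ (0 : K)^' --> (0 : K) ->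
  exists M : K, \forall z \near (0 : K)^', `|w z| <= M * `|z|.
Proof.
move=> P0 Pw wC w0.
have [ord [C [C1 oC]]] := newton_pair P0.
have C0 : 0 < C by exact: lt_le_trans ltr01 C1.
pose q := ((size P)`!)%N; have q0 : (0 < q)%N by exact: fact_gt0.
pose v (t : K) := w (t ^+ q).
have vP : \forall t \near (0 : K)^', eval2 P (t ^+ q) (v t) = 0.
  exact: (near_dnbhs0_expr q0 Pw).
have vC : \forall t \near (0 : K)^', {for t, continuous v}.
  near=> t; apply: continuous_comp; first exact: continuous_expr.
  by near: t; exact: (near_dnbhs0_expr q0 wC).
have v0 : v @ (0 : K)^' --> (0 : K).
  apply/cvgr0Pnorm_lt => e e0.
  apply: (near_dnbhs0_expr q0 (S := fun z => `|w z| < e)).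
  exact: cvgr0_norm_lt w0 _ e0.
have voC := near_dnbhs0_expr q0 oC.
have vM m : (m <= q)%N ->
    exists M : K, \forall t \near (0 : K)^', `|v t| <= M * `|t| ^+ m.
  elim: m => [_|m IH mq].
    exists 1; near=> t; rewrite expr0 mulr1 ltW //.
    by near: t; exact: cvgr0_norm_lt v0 _ ltr01.
  have [M vM] := IH (ltnW mq).
  pose g (t : K) := v t / t ^+ m.
  have gM : \forall t \near (0 : K)^', `|g t| <= M.
    near=> t; have t0 : t != 0 by near: t; exact: nbhs_dnbhs_neq.
    rewrite normrM normfV normrX ler_pdivrMr ?exprn_gt0 ?normr_gt0 //.
    by near: t; exact: vM.
  have gC : \forall t \near (0 : K)^', {for t, continuous g}.
    near=> t; have t0 : t != 0 by near: t; exact: nbhs_dnbhs_neq.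
    have vt : {for t, continuous v} by near: t; exact: vC.
    have tm : {for t, continuous (fun t : K => t ^+ m)} by exact: continuous_expr.
    exact: (continuous_div vt tm (expf_neq0 m t0)).
  pose S := substitute 'X^q (('X^m)%:P * 'X) P.
  have S0 : S != 0.
    apply: substitute_neq0 => //; first by rewrite size_polyXn.
    by rewrite size_mulX ?size_polyC ?polyC_eq0 monic_neq0 // monicXn.
  have gP : \forall t \near (0 : K)^', eval2 S t (g t) = 0.
    near=> t; have t0 : t != 0 by near: t; exact: nbhs_dnbhs_neq.
    rewrite eval2_substitute hornerXn eval2M eval2C eval2X hornerXn.
    by rewrite mulrC divfK ?expf_neq0 //; near: t; exact: vP.
  have [l gl] := algebraic_limit S0 gP gC gM.
  have l0 : l = 0.
    have [m0|m0] := posnP m.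
      apply: dnbhs0_cvg_unique gl _; apply: cvg_trans v0.
      by rewrite /g m0; under [X in X @ _]funext do rewrite expr0 divr1.
    have [u u1 uP] := primitive_root_exists q0.
    have um1 : u ^+ m != 1 by rewrite uP gtnNdvd.
    have uq1 : u ^+ q = 1 by apply/eqP; rewrite uP.
    have gul : (fun t => g (u * t)) @ (0 : K)^' --> l.
      apply/cvgrPdist_lt => e e0.
      apply: (near_dnbhs0_unit u1 (S := fun z => `|l - g z| < e)).
      by move/cvgrPdist_lt: gl; exact.
    have gu t : g (u * t) = (u ^+ m)^-1 * g t.
      by rewrite /g /v !exprMn uq1 mul1r invfM mulrCA.
    have gul' : (fun t => g (u * t)) @ (0 : K)^' --> (u ^+ m)^-1 * l.
      rewrite (_ : (fun _ => _) = fun t => (u ^+ m)^-1 * g t); last exact/funext.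
      exact: (cvgM (cvg_cst _) gl).
    move/eqP: (dnbhs0_cvg_unique gul gul').
    rewrite -subr_eq0 -{1}[l]mul1r -mulrBl mulf_eq0 => /orP[|/eqP//].
    by rewrite subr_eq0 eq_sym invr_eq1 (negPf um1).
  exists C; rewrite l0 in gl.
  pose d : K := (C * 2)^-1.
  have d0 : 0 < d by rewrite invr_gt0 mulr_gt0.
  have Cd : C * d < 1.
    by rewrite /d invfM mulrA divff ?gt_eqF // mul1r invf_lt1 // ltr1n.
  have d1 : d <= 1 by rewrite ltW // (le_lt_trans _ Cd) // ler_peMl // ltW.
  near=> t.
  have t0 : t != 0 by near: t; exact: nbhs_dnbhs_neq.
  have t1 : `|t| < 1 by near: t; exact: near_dnbhs0_norm_lt.
  have [->|vt0] := eqVneq (v t) 0.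
    by rewrite normr0 mulr_ge0 ?exprn_ge0 // ltW.
  have gtd : `|g t| < d.
    by near: t; exact: cvgr0_norm_lt gl _ d0.
  have vd : `|v t| <= d * `|t| ^+ m.
    rewrite ltW // -ltr_pdivrMr ?exprn_gt0 ?normr_gt0 //.
    by rewrite -normrX -normfV -normrM.
  have Pt : eval2 P (t ^+ q) (v t) = 0 by near: t; exact: vP.
  have : forall y, eval2 P (t ^+ q) y = 0 -> y != 0 ->
      exists j k, [/\ (j < k < size P)%N,
        `|y| ^+ k * `|t ^+ q| ^+ ord k <= C * (`|y| ^+ j * `|t ^+ q| ^+ ord j) &
        `|y| ^+ j * `|t ^+ q| ^+ ord j <= C * (`|y| ^+ k * `|t ^+ q| ^+ ord k)].
    by near: t; exact: voC.
  move=> /(_ _ Pt vt0)[j [k [/andP[jk kP] vk vj]]].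
  rewrite normrX -!exprM in vk vj.
  apply: (@newton_step _ _ _ _ d (ord k) (ord j) j k q m) => //.
  - by rewrite normr_gt0.
  - by rewrite normr_gt0 t0.
  - by rewrite (ltW d0).
  apply: dvdn_fact; rewrite subn_gt0 jk /=.
  exact: leq_trans (leq_subr _ _) (ltnW kP).
have [M MP] := vM q (leqnn q).
exists M; near=> z.
have [t <- vt] : exists2 t, t ^+ q = z & `|v t| <= M * `|t| ^+ q.
  by near: z; exact: (near_dnbhs0_root q0 MP).
by rewrite normrX.
Unshelve. all: by end_near.
Qed.

(** The difference quotient is bounded by [algebraic_vanishing], and it is
    again continuous and algebraic off a, so that it has a limit by
    [algebraic_limit]. *)
Lemma algebraic_derivable (P : {poly {poly K}}) (f : K -> K) (a : K) :
  P != 0 -> (\forall z \near a, eval2 P z (f z) = 0) ->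
  (\forall z \near a, {for z, continuous f}) -> derivable f a 1.
Proof.
move=> P0 Pf fC.
pose w (h : K) := f (h + a) - f a.
have idc (h : K) : {for h, continuous (fun t : K => t)} by exact: cvg_id.
have sh (h : K) : {for h, continuous (fun t : K => t + a)}.
  exact: (continuousD (idc h) (@cst_continuous _ _ a h)).
have near_sh (S : K -> Prop) : (\forall z \near a, S z) ->
    \forall h \near (0 : K)^', S (h + a).
  by move=> Sa; apply: nbhs_dnbhs; apply: (sh 0); rewrite /= add0r.
pose P1 := substitute ('X + a%:P) ('X + (f a)%:P%:P) P.
have P10 : P1 != 0 by apply: substitute_neq0; rewrite ?size_XaddC.
have P1w : \forall h \near (0 : K)^', eval2 P1 h (w h) = 0.
  near=> h; rewrite eval2_substitute hornerD hornerX hornerC.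
  rewrite eval2D eval2X eval2C hornerC subrK; near: h.
  exact: (near_sh (fun z => eval2 P z (f z) = 0)).
have wc (h : K) : {for h + a, continuous f} -> {for h, continuous w}.
  move=> fh.
  exact: (continuousB (continuous_comp (sh h) fh) (@cst_continuous _ _ (f a) h)).
have wC : \forall h \near (0 : K)^', {for h, continuous w}.
  near=> h; apply: wc; near: h.
  exact: (near_sh (fun z => {for z, continuous f})).
have w0 : w @ (0 : K)^' --> (0 : K).
  have fa : {for a, continuous f} by exact: nbhs_singleton fC.
  rewrite -[a]add0r in fa.
  have w00 : w 0 = 0 by rewrite /w add0r subrr.
  have wc0 : w @ (0 : K) --> w 0 by exact: wc 0 fa.
  by rewrite w00 in wc0; exact: cvg_within_filter wc0.
have [M wM] := algebraic_vanishing P10 P1w wC w0.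
pose g (h : K) := w h / h.
pose P2 := substitute 'X ('X%:P * 'X) P1.
have P20 : P2 != 0.
  apply: substitute_neq0 => //; first by rewrite size_polyX.
  by rewrite size_mulX ?size_polyC ?polyC_eq0 polyX_eq0.
have P2g : \forall h \near (0 : K)^', eval2 P2 h (g h) = 0.
  near=> h; have h0 : h != 0 by near: h; exact: nbhs_dnbhs_neq.
  rewrite eval2_substitute hornerX eval2M eval2C eval2X hornerX.
  by rewrite mulrC divfK //; near: h; exact: P1w.
have gC : \forall h \near (0 : K)^', {for h, continuous g}.
  near=> h; have h0 : h != 0 by near: h; exact: nbhs_dnbhs_neq.
  have wh : {for h, continuous w} by near: h; exact: wC.
  exact: (continuous_div wh (idc h) h0).
have gM : \forall h \near (0 : K)^', `|g h| <= M.
  near=> h; have h0 : h != 0 by near: h; exact: nbhs_dnbhs_neq.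
  rewrite normrM normfV ler_pdivrMr ?normr_gt0 //.
  by near: h; exact: wM.
have [l gl] := algebraic_limit P20 P2g gC gM.
apply/cvg_ex; exists l.
rewrite (_ : (fun h => _) = g) //; apply/funext => h.
by rewrite /g /w /= -[_ *: _]/(_ * _) -[_ *: _]/(_ * _) mulr1 mulrC.
Unshelve. all: by end_near.
Qed.

End Removable.

(** * Blowing up *)

Section Blowup.
Variable R : realType.
Local Notation K := (Cplx R).

Lemma near_shift_dnbhs (a : K) (S : K -> Prop) :
  (\forall z \near a^', S z) <-> (\forall h \near (0 : K)^', S (h + a)).
Proof.
split=> [/nbhs_ballP[r /= r0 rS]|/near_dnbhs0[r r0 rS]].
  apply/near_dnbhs0; exists r => // h /andP[h0 hr]; apply: rS.
    by rewrite -ball_normE /= opprD addrCA subrr addr0 normrN.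
  by rewrite -subr_eq0 addrK -normr_gt0.
apply/nbhs_ballP; exists r => // z /=; rewrite -ball_normE /= distrC => zr za.
rewrite -(subrK a z); apply: rS.
by rewrite /punctured_disc /= normr_gt0 subr_eq0 za.
Qed.

Lemma poly_near_eq0 (p : {poly K}) (a : K) :
  (\forall z \near a^', p.[z] = 0) -> p = 0.
Proof.
move=> /near_shift_dnbhs pa; apply/eqP; apply: contraT => p0.
have q0 : p \Po ('X + a%:P) != 0 by rewrite comp_poly_eq0 ?size_XaddC.
have [i [A [_ iA]]] := poly_order q0.
suff: \forall h \near (0 : K)^', False by move=> /filter_ex[].
near=> h; have h0 : h != 0 by near: h; exact: nbhs_dnbhs_neq.
have [_] : `|(p \Po ('X + a%:P)).[h]| <= A * `|h| ^+ i /\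
  `|h| ^+ i <= A * `|(p \Po ('X + a%:P)).[h]| by near: h; exact: iA.
rewrite horner_comp !hornerE (_ : p.[h + a] = 0); last by near: h; exact: pa.
by rewrite normr0 mulr0 lt_geF // exprn_gt0 // normr_gt0.
Unshelve. all: by end_near.
Qed.

Lemma poly_eq0 (p : {poly K}) : (forall z, p.[z] = 0) -> p = 0.
Proof. by move=> p0; apply: (@poly_near_eq0 p 0); near=> z; exact: p0.
Unshelve. all: by end_near.
Qed.

Lemma near_open_dnbhs (U : set K) (a : K) : open U -> U a ->
  \forall z \near a^', U z.
Proof. by move=> oU Ua; apply: nbhs_dnbhs; exact: open_nbhs_nbhs. Qed.

Lemma continuous_eval2 (P : {poly {poly K}}) (w : K -> K) (z : K) :
  {for z, continuous w} -> {for z, continuous (fun t => eval2 P t (w t))}.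
Proof.
move=> wz; elim/poly_ind: P => [|P p IH].
  have -> : (fun t => eval2 (0 : {poly {poly K}}) t (w t)) = cst 0.
    by apply/funext => t; rewrite eval20.
  exact: cst_continuous.
have -> : (fun t => eval2 (P * 'X + p%:P) t (w t)) =
    (fun t => eval2 P t (w t) * w t + p.[t]).
  by apply/funext => t; rewrite eval2D eval2M eval2X eval2C.
exact: (continuousD (continuousM IH wz) (@continuous_poly _ p z)).
Qed.

Lemma continuous_eq0 (f : K -> K) (a : K) : {for a, continuous f} ->
  (\forall z \near a^', f z = 0) -> f a = 0.
Proof.
move=> fa f0; apply/eqP; rewrite -normr_le0; apply: contraT.
rewrite -real_ltNge ?normr_real ?real0 // => fa0.
suff: \forall z \near a^', False by move=> /filter_ex[].
move/cvgrPdist_lt: fa => /(_ _ fa0)/nbhs_dnbhs fa.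
near=> z; have : `|f a - f z| < `|f a| by near: z; exact: fa.
by rewrite (_ : f z = 0) ?subr0 ?ltxx //; near: z; exact: f0.
Unshelve. all: by end_near.
Qed.

Definition divided_difference (y : K -> K) (a z : K) : K :=
  if z == a then derive1 y a else (y z - y a) / (z - a).

Lemma divided_differenceE y a z :
  y z = y a + (z - a) * divided_difference y a z.
Proof.
rewrite /divided_difference; have [->|za] := eqVneq z a.
  by rewrite subrr mul0r addr0.
by rewrite mulrCA divff ?mulr1 ?subr_eq0 // addrC subrK.
Qed.

Lemma continuous_divided_difference (U : set K) y a : open U ->
  holomorphic U y -> U a ->
  forall z, U z -> {for z, continuous (divided_difference y a)}.
Proof.
move=> oU hy Ua z Uz; have [->|za] := eqVneq z a.
  apply/continuous_withinNx/cvgrPdist_lt => e e0.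
  apply/near_shift_dnbhs.
  have ya := hy a Ua; rewrite /derivable in ya.
  have yE : (fun h : K => h^-1 *: ((y \o shift a) (h *: 1) - y a)) =
      (fun h => h^-1 *: (y (h + a) - y a)).
    by apply/funext => h /=; rewrite -[h *: 1]/(_ * _) mulr1.
  rewrite yE in ya.
  have : (fun h => h^-1 *: (y (h + a) - y a)) @ (0 : K)^' --> derive1 y a.
    exact: ya.
  move=> /cvgrPdist_lt /(_ e e0) ye.
  near=> h; have h0 : h != 0 by near: h; exact: nbhs_dnbhs_neq.
  have : `|derive1 y a - h^-1 *: (y (h + a) - y a)| < e by near: h; exact: ye.
  rewrite /divided_difference eqxx -subr_eq0 addrK (negPf h0).
  by rewrite -[_ *: _]/(_ * _) mulrC.
have yz : {for z, continuous y}.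
  exact/differentiable_continuous/derivable1_diffP/hy.
have zc : {for z, continuous (fun t : K => t - a)}.
  by apply: continuousB; [exact: cvg_id|exact: cst_continuous].
have za0 : z - a != 0 by rewrite subr_eq0.
have qz := continuous_div (continuousB yz (@cst_continuous _ _ (y a) z)) zc za0.
have zE : {near z, (fun t => (y t - y a) / (t - a)) =1 divided_difference y a}.
  have zc0 : \forall t \near z, t - a != 0.
    move/cvgrPdist_lt: zc => /(_ _ _)/= zc; near=> t.
    have : `|z - a - (t - a)| < `|z - a| by near: t; apply: zc; rewrite normr_gt0.
    by apply: contraTneq => ->; rewrite subr0 ltxx.
  near=> t; rewrite /divided_difference -subr_eq0 ifN //; near: t; exact: zc0.
have qz' : (fun t => (y t - y a) / (t - a)) @ z --> divided_difference y a z.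
  have <- : (y z - y a) / (z - a) = divided_difference y a z.
    exact: nbhs_singleton zE.
  exact: qz.
exact: (cvg_trans (near_eq_cvg zE) qz').
Unshelve. all: by end_near.
Qed.

Lemma deriv_eq0_const (p : {poly K}) x : p^`() = 0 -> p.[x] = 0 -> p = 0.
Proof.
move=> p'0 px; have pC : p = (p`_0)%:P.
  apply/polyP => -[|i]; rewrite coefC //=.
  move/polyP/(_ i)/eqP: p'0; rewrite coef_deriv coef0.
  by rewrite -mulr_natr mulf_eq0 pnatr_eq0 orbF => /eqP.
by move: px; rewrite pC hornerC => ->.
Qed.

(** Blowing up a point of the curve where P_y vanishes. As y is differentiable
    there P_z vanishes too, so the total transform P(z, y(a) + (z - a) w) is
    divisible by (z - a)^2. Dividing by it removes a factor z - a from P_y,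
    hence from the element r of the ideal (P, P_y). *)
Lemma blowup (U : set K) (y : K -> K) (P u v : {poly {poly K}})
    (r : {poly K}) a :
  open U -> holomorphic U y -> U a ->
  (forall z, U z -> eval2 P z (y z) = 0) ->
  r != 0 -> r%:P = u * P + v * P^`() -> eval2 P^`() a (y a) = 0 ->
  let w := divided_difference y a in
  exists Q u' v' r', [/\ holomorphic U w,
    forall z, U z -> eval2 Q z (w z) = 0,
    r' != 0, r'%:P = u' * Q + v' * Q^`() & (size r' < size r)%N].
Proof.
move=> oU hy Ua Py r0 ruv Dya w.
pose l := 'X - a%:P.
have l0 : l%:P != 0 :> {poly {poly K}} by rewrite polyC_eq0 polyXsubC_eq0.
pose L := l%:P * 'X + (y a)%:P%:P.
pose P1 := substitute 'X L P.
have P1E z x : eval2 P1 z x = eval2 P z (y a + (z - a) * x).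
  rewrite eval2_substitute hornerX eval2D eval2M !eval2C eval2X hornerC.
  by rewrite hornerXsubC addrC.
have dP1 : P1^`() = l%:P * substitute 'X L P^`().
  rewrite deriv_substitute derivD derivM !derivC derivX.
  by rewrite mul0r add0r addr0 mulr1 mulrC.
have spec0 S : (forall x, eval2 S a x = 0) -> specialize a S = 0.
  by move=> S0; apply: poly_eq0 => x; rewrite -eval2E.
have Ey z : y a + (z - a) * w z = y z by rewrite -divided_differenceE.
have wC := continuous_divided_difference oU hy Ua.
have near_lift S1 S2 :
    (forall z, U z -> eval2 S1 z (w z) = 0) -> S1 = l%:P * S2 ->
    forall z, U z -> eval2 S2 z (w z) = 0.
  move=> S10 S12.
  have off z : U z -> z != a -> eval2 S2 z (w z) = 0.
    move=> Uz za; have := S10 z Uz; rewrite S12 eval2M eval2C hornerXsubC.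
    by move=> /eqP; rewrite mulf_eq0 subr_eq0 (negPf za) => /eqP.
  move=> z Uz; have [->|] := eqVneq z a; last exact: off.
  apply: (@continuous_eq0 (fun t => eval2 S2 t (w t))).
    exact/continuous_eval2/wC.
  near=> t; apply: off; first by near: t; exact: near_open_dnbhs.
  by near: t; exact: nbhs_dnbhs_neq.
have P1w z : U z -> eval2 P1 z (w z) = 0 by move=> Uz; rewrite P1E Ey Py.
(* The first factor z - a comes from P(a, y(a)) = 0. *)
have [P2 P12] : exists P2, P1 = l%:P * P2.
  apply/specialize_eq0/spec0 => x.
  by rewrite P1E subrr mul0r addr0 Py.
have P2w := near_lift _ _ P1w P12.
have dP2 : P2^`() = substitute 'X L P^`().
  by apply: (mulfI l0); rewrite -dP1 P12 derivM derivC mul0r add0r.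
have dP20 : specialize a P2^`() = 0.
  apply: spec0 => x; rewrite dP2 eval2_substitute hornerX eval2D eval2M !eval2C.
  by rewrite eval2X hornerC hornerXsubC subrr mul0r add0r.
(* The second one: P2(a,.) is constant because P_y(a, y(a)) = 0, and it vanishes
   at w(a) by continuity. *)
have [Q P2Q] : exists Q, P2 = l%:P * Q.
  apply: specialize_eq0; apply: (@deriv_eq0_const _ (w a)).
    by rewrite /specialize deriv_map.
  by rewrite -eval2E P2w.
have Qw := near_lift _ _ P2w P2Q.
have dQ : substitute 'X L P^`() = l%:P * Q^`().
  by rewrite -dP2 P2Q derivM derivC mul0r add0r.
pose u' := l%:P * substitute 'X L u; pose v' := substitute 'X L v.
have rE : r%:P = l%:P * (u' * Q + v' * Q^`()).
  have := congr1 (substitute 'X L) ruv.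
  rewrite substituteC comp_polyXr => ->.
  rewrite substituteD !substituteM -/P1 dQ P12 P2Q /u' /v' mulrDr.
  by congr (_ + _); [rewrite mulrA mulrCA -!mulrA|]; rewrite mulrCA.
pose s := u' * Q + v' * Q^`(); pose r' := s`_0.
have rr' : r = l * r'.
  have := congr1 (fun p : {poly {poly K}} => p`_0) rE.
  by rewrite coefC coefCM.
have sE : s = r'%:P.
  by apply: (mulfI l0); rewrite -rE rr' polyCM.
have r'0 : r' != 0 by apply: contraNneq r0 => r'0; rewrite rr' r'0 mulr0.
exists Q, u', v', r'; split; last 4 first.
- exact: Qw.
- exact: r'0.
- by rewrite -sE.
- by rewrite rr' size_mul ?polyXsubC_eq0 // size_XsubC.
have Q0 : Q != 0.
  apply: contraNneq r'0 => Q0; move: sE; rewrite /s Q0 deriv0 !mulr0 addr0.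
  by move/eqP; rewrite eq_sym polyC_eq0.
move=> z Uz; apply: (algebraic_derivable Q0); near=> t.
  by apply: Qw; near: t; exact: open_nbhs_nbhs.
by apply: wC; near: t; exact: open_nbhs_nbhs.
Unshelve. all: by end_near.
Qed.

(** Each blow-up lowers the degree of r. When none is left to be done, P_y has
    no zero on the graph, and the blow-up formulas compose to a polynomial S. *)
Lemma etale_model (U : set K) (y : K -> K) (P u v : {poly {poly K}})
    (r : {poly K}) :
  open U -> holomorphic U y -> (forall z, U z -> eval2 P z (y z) = 0) ->
  r != 0 -> r%:P = u * P + v * P^`() ->
  exists (w : K -> K) Q S, [/\ holomorphic U w,
    forall z, U z -> eval2 Q z (w z) = 0,
    forall z, U z -> eval2 Q^`() z (w z) != 0 &
    forall z, U z -> y z = eval2 S z (w z)].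
Proof.
move=> oU; have [m] := ubnP (size r).
elim: m y P u v r => // m IH y P u v r rm hy Py r0 ruv.
have [[a Ua Da]|D0] := pselect (exists2 a, U a & eval2 P^`() a (y a) = 0);
  last first.
  exists y, P, 'X; split=> // z Uz; last by rewrite eval2X.
  by apply/eqP => Dz; apply: D0; exists z.
have [Q [u' [v' [r' [hw Qw r'0 r'uv r'r]]]]] := blowup oU hy Ua Py r0 ruv Da.
have [|w [Q' [S [hw' Qw' Dw' wS]]]] := IH _ _ _ _ _ _ hw Qw r'0 r'uv.
  by rewrite -ltnS (leq_trans _ rm).
exists w, Q', ((y a)%:P%:P + ('X - a%:P)%:P * S); split=> // z Uz.
rewrite eval2D eval2M !eval2C hornerC hornerXsubC -wS //.
exact: divided_differenceE.
Qed.

Lemma integral_function_ext (U : set K) (f g : K -> K) :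
  (forall z, U z -> f z = g z) ->
  integral_function U f -> integral_function U g.
Proof.
move=> fg [N [x [ix [p fp]]]]; exists N, x; split=> //; exists p => z Uz.
by rewrite -fg // fp.
Qed.

End Blowup.

(** * Algebraic functions are integral *)

Theorem proposition1p7 (R : realType) (U : set (Cplx R)) (y : Cplx R -> Cplx R) :
  open U -> connected U -> holomorphic U y ->
  (exists2 P : {poly {poly (Cplx R)}},
     P != 0 & forall z, U z -> P.[(y z)%:P].[z] = 0) ->
  integral_function U y.
Proof.
move=> oU _ hy [P P0 Py].
have [[a Ua]|U0] := pselect (exists a, U a); last first.
  (* On the empty set every relation between functions holds. *)
  have U0' z : ~ U z by move=> Uz; apply: U0; exists z.
  apply: (@integral_function_ext _ _ (fun z => eval2 'X z (y z))).
    by move=> z /U0'.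
  by apply: (@etale_integral_function _ _ y y 0) => // z /U0'.
have Udense p : (forall z, U z -> p.[z] = 0) -> p = 0.
  move=> pU; apply: (@poly_near_eq0 _ p a).
  by near=> z; apply: pU; near: z; exact: near_open_dnbhs.
have [Q [u [v [r [r0 ruv Qy]]]]] := separable_annihilator Udense P0 Py.
have [w [Q' [S [hw Qw Dw yS]]]] := etale_model oU hy Qy r0 ruv.
apply: (@integral_function_ext _ _ (fun z => eval2 S z (w z))).
  by move=> z Uz; rewrite yS.
apply: (@etale_integral_function _ _ w
  (fun z => (eval2 Q'^`() z (w z))^-1) Q') => //.
by move=> z Uz; rewrite divff // Dw.
Unshelve. all: by end_near.
Qed.
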